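(* Let $k$ be a field, let $G$ and $\mathcal{G}$ be groups, let $\pi : G \to \mathrm{Aut}_{\mathrm{Group}}(\mathcal{G})$ be a group homomorphism, and let $\theta \in \mathrm{Aut}_{\mathrm{Group}}(\mathcal{G})$. Suppose that the $(\theta)$-orbits of $\mathcal{G}$ are finite and that $\theta_{k[\mathcal{G}]}$ is diagonalizable. Assume further that: (a) $\pi(g)\circ\theta = \theta\circ\pi(g)$ for all $g \in G$. (b) There exists an isomorphism $U \to \mathbf{U}$ ($\lambda \mapsto \boldsymbol{\lambda}$) from the subgroup $U \subseteq k^\times$ generated by the eigenvalues of $\theta_{k[\mathcal{G}]}$ to a subgroup $\mathbf{U}$ of $G$ which satisfies $\mathbf{U} \subseteq \mathrm{Ker}(\pi) \cap \mathrm{Z}(G)$. Let $H = k[G]$ and $B = k[\mathcal{G}]$. Then: (c) The Hopf algebra $B$ over $k$ is also a Hopf algebra of ${}^H_H\mathcal{YD}$, where its $H$-module structure is given by $g\cdot b = \pi(g)(b)$ for all $g \in G$ and $b \in \mathcal{G}$, and its $H$-comodule structure is given by $\rho(b) = \boldsymbol{\lambda} \otimes b$ for $b \in B_{(\lambda)}$. (d) The biproduct $B \times H$ is a cosemisimple involutory Hopf algebra over $k$. In particular $$B \times H \simeq \bigoplus_{\mathcal{O} \in \mathrm{Orb}(\mathcal{G}, \theta)} [G : \mathbf{U}_{|\mathcal{O}|}]\cdot \mathrm{C}_{|\mathcal{O}|}(k)$$ as coalgebras.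
   Context: Group algebras are Hopf algebras in the usual way. $(\theta)$ is the cyclic group generated by $\theta$; $\mathrm{Orb}(\mathcal{G},\theta)$ is the set of $(\theta)$-orbits of $\mathcal{G}$. $\theta_{k[\mathcal{G}]}$ is the linear extension of $\theta$ to $k[\mathcal{G}]$. An endomorphism of a vector space is diagonalizable if the space is the sum of its eigenspaces (over $k$). $B_{(\lambda)}$ is the eigenspace of $\theta_{k[\mathcal{G}]}$ for $\lambda \in k$. $\mathrm{Z}(G)$ is the center of $G$. $\mathbf{U}_r$ denotes the unique subgroup of $\mathbf{U}$ of order $r$ (it exists for each orbit length $r$). $m\cdot V$ is the direct sum of $m$ copies of $V$, for a cardinal $m$. $\mathrm{C}_r(k)$ is the coalgebra with basis $\{c_{i\,j}\}_{1 \le i,j \le r}$ and $\Delta(c_{i\,j}) = \sum_{\ell=1}^r c_{i\,\ell} \otimes c_{\ell\,j}$, $\epsilon(c_{i\,j}) = \delta_{i,j}$. Involutory means the antipode $S$ satisfies $S^2 = \mathrm{I}$. ${}_H^H\mathcal{YD}$ is the category of left-left Yetter–Drinfel'd modules: left $H$-modules and left $H$-comodules $M$, $\rho(m) = m_{(-1)} \otimes m_{(0)}$, with $h_{(1)}m_{(-1)} \otimes h_{(2)}\cdot m_{(0)} = (h_{(1)}\cdot m)_{(-1)}h_{(2)} \otimes (h_{(1)}\cdot m)_{(0)}$; morphisms are $H$-linear and $H$-colinear maps. A Hopf algebra of ${}_H^H\mathcal{YD}$ is an object $B$ which is a $k$-algebra and $k$-coalgebra all of whose structure maps are morphisms (i.e.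 a left $H$-module algebra, $H$-comodule algebra, $H$-module coalgebra, $H$-comodule coalgebra), with $\epsilon$ an algebra map, $\Delta(1) = 1 \otimes 1$, $\Delta(bb') = b_{(1)}(b_{(2)(-1)}\cdot b'_{(1)}) \otimes b_{(2)(0)}b'_{(2)}$, and with a morphism $S$ satisfying $S(b_{(1)})b_{(2)} = \epsilon(b)1 = b_{(1)}S(b_{(2)})$. The biproduct $B \times H$ is the Hopf algebra over $k$ on $B \otimes H$ (tensors written $b \times h$) with $(b \times h)(b' \times h') = b(h_{(1)}\cdot b') \times h_{(2)}h'$, identity $1 \times 1$, $\Delta(b \times h) = (b_{(1)} \times b_{(2)(-1)}h_{(1)}) \otimes (b_{(2)(0)} \times h_{(2)})$, $\epsilon(b \times h) = \epsilon(b)\epsilon(h)$. *)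

(* Defs.v *)
From HB Require Import structures.
From mathcomp Require Import all_boot ssralg generic_quotient ring_quotient.
From mathcomp Require Import finmap.
From mathcomp Require Import boolp classical_sets functions cardinality fsbigop.
From mathcomp.multinomials Require Import monalg.

Set Implicit Arguments.
Unset Strict Implicit.
Unset Printing Implicit Defensive.

Import GRing.Theory.

Local Open Scope ring_scope.
Local Open Scope quotient_scope.
Local Open Scope card_scope.
Local Open Scope classical_set_scope.

(** * Linear spans, linear extension, tensor products *)

Section Span.
Variables (k : fieldType) (V : lmodType k) (X : set V).

Definition lspan : set V := smallest (fun S : set V => submod_closed (mem S)) X.

Definition in_lspan : {pred V} := mem lspan.

Fact in_lspan_submod : submod_closed in_lspan.
Proof.
split=> [|a x y xK yK]; rewrite inE => S [[S0 Sl] relS].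
  by rewrite inE in S0.
have [xS yS] : x \in S /\ y \in S.
  by split; rewrite inE; [move: xK|move: yK]; rewrite inE; apply.
by move: (Sl a x y xS yS); rewrite inE.
Qed.

HB.instance Definition _ := GRing.isSubmodClosed.Build k V in_lspan
  (GRing.submod_closed_semi in_lspan_submod).

Definition lquot : Type := Quotient.quot in_lspan.

HB.instance Definition _ := GRing.Zmodule.on lquot.

Definition lquot_pi (x : V) : lquot := \pi_(Quotient.quot in_lspan) x.
Definition lquot_repr (t : lquot) : V := repr t.

Fact lquot_reprK : cancel lquot_repr lquot_pi.
Proof. exact: reprK. Qed.

Lemma lquot_piP x y : (lquot_pi x = lquot_pi y) <-> lspan (x - y).
Proof.
split=> [/eqP|xy].
  by rewrite -(Quotient.idealrBE in_lspan) inE.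
by apply/eqP; rewrite -(Quotient.idealrBE in_lspan) inE.
Qed.

Fact lquot_piD : {morph lquot_pi : x y / x + y}.
Proof. exact: (raddfD (\pi_(Quotient.quot in_lspan))). Qed.

Definition lquot_scale (a : k) (t : lquot) : lquot :=
  lquot_pi (a *: lquot_repr t).

Fact lquot_scale_pi a x : lquot_scale a (lquot_pi x) = lquot_pi (a *: x).
Proof.
apply/lquot_piP; rewrite -scalerBr.
suff: a *: (lquot_repr (lquot_pi x) - x) \in in_lspan by rewrite inE.
by rewrite rpredZ // inE; apply/lquot_piP; rewrite lquot_reprK.
Qed.

Fact lquot_scaleA a b t :
  lquot_scale a (lquot_scale b t) = lquot_scale (a * b) t.
Proof. by rewrite -[t]lquot_reprK !lquot_scale_pi scalerA. Qed.

Fact lquot_scale1 : left_id 1 lquot_scale.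
Proof. by move=> t; rewrite -[t]lquot_reprK !lquot_scale_pi scale1r. Qed.

Fact lquot_scaleDr : right_distributive lquot_scale +%R.
Proof.
move=> a t u; rewrite -[t]lquot_reprK -[u]lquot_reprK -lquot_piD.
by rewrite !lquot_scale_pi scalerDr lquot_piD.
Qed.

Fact lquot_scaleDl t : {morph lquot_scale^~ t : a b / a + b}.
Proof.
move=> a b; rewrite -[t]lquot_reprK !lquot_scale_pi scalerDl.
exact: lquot_piD.
Qed.

HB.instance Definition _ := GRing.Zmodule_isLmodule.Build k lquot
  lquot_scaleA lquot_scale1 lquot_scaleDr lquot_scaleDl.

Fact lquot_pi_is_linear : linear lquot_pi.
Proof. by move=> a x y; rewrite lquot_piD -lquot_scale_pi. Qed.

HB.instance Definition _ :=
  GRing.isLinear.Build k V lquot *:%R lquot_pi lquot_pi_is_linear.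

End Span.

HB.lock Definition lext (k : fieldType) (K : choiceType) (V : lmodType k)
    (f : K -> V) (x : {malg k[K]}) : V :=
  \sum_(i <- msupp x) x@_i *: f i.

Section LinearExtension.
Variables (k : fieldType) (K : choiceType) (V : lmodType k).
Implicit Types (f : K -> V) (x : {malg k[K]}).

Lemma lextE f x : lext f x = \sum_(i <- msupp x) x@_i *: f i.
Proof. by rewrite unlock. Qed.

Lemma lextEw f x (D : {fset K}) :
  (msupp x `<=` D)%fset -> lext f x = \sum_(i <- D) x@_i *: f i.
Proof.
move=> sD; rewrite lextE [RHS](big_fsetID _ (mem (msupp x))) /=.
rewrite [X in _ = _ + X]big1_fset ?addr0; last first.
  by move=> i; rewrite !inE => /andP[_ /mcoeff_outdom->]; rewrite scale0r.
apply: eq_fbigl => i; rewrite !inE; case: (boolP (i \in msupp x)) => //=.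
  by move=> /(fsubsetP sD)->.
by rewrite andbF.
Qed.

Lemma lext_is_linear f : linear (lext f).
Proof.
move=> a x y; pose D := (msupp x `|` msupp y `|` msupp (a *: x + y))%fset.
rewrite !(@lextEw f _ D) ?fsubsetUl ?fsubsetUr //.
- rewrite scaler_sumr -big_split; apply: eq_bigr => i _ /=.
  by rewrite mcoeffD mcoeffZ scalerDl scalerA.
- by apply: fsubset_trans (fsubsetUl _ _); exact: fsubsetUr.
- by apply: fsubset_trans (fsubsetUl _ _); exact: fsubsetUl.
Qed.

HB.instance Definition _ f :=
  GRing.isLinear.Build k {malg k[K]} V *:%R (lext f) (lext_is_linear f).

Lemma lextU f i : lext f << i >> = f i.
Proof.
rewrite (@lextEw _ _ [fset i]%fset) ?msuppU_le //.
by rewrite big_seq_fset1 mcoeffUU scale1r.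
Qed.

End LinearExtension.

Definition bilinear (k : fieldType) (U V W : lmodType k) (f : U -> V -> W) :=
  (forall v, linear (f^~ v)) /\ (forall u, linear (f u)).

Section Tensor.
Variables (k : fieldType) (V W : lmodType k).

Local Notation free := {malg k[(V * W)%type]}.

Definition tens_rel : set free :=
  [set r | exists a v v' w,
     r = << (a *: v + v', w) >> - a *: << (v, w) >> - << (v', w) >>] `|`
  [set r | exists a v w w',
     r = << (v, a *: w + w') >> - a *: << (v, w) >> - << (v, w') >>].

Definition tensor : Type := lquot tens_rel.

HB.instance Definition _ := GRing.Lmodule.on tensor.

End Tensor.

HB.lock Definition tens (k : fieldType) (V W : lmodType k) (v : V) (w : W) :
    tensor V W :=
  lquot_pi (@tens_rel k V W) << (v, w) >>.

(** Sweedler sums: [\tsum_(v, w <- t) F] is the value at [t] of the linear map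
    [V ⊗ W -> X] sending [v ⊗ w] to [F].  It is computed on a chosen
    representative of [t], so it is meaningful only if [F] is bilinear in
    [(v, w)]; see [tsum_linear] and [tsum_tens]. *)
HB.lock Definition tsum (k : fieldType) (V W X : lmodType k)
    (f : V -> W -> X) (t : tensor V W) : X :=
  lext (fun p => f p.1 p.2) (lquot_repr t).

Section TensorTheory.
Variables (k : fieldType) (V W : lmodType k).

Local Notation tensor := (tensor V W).
Local Notation tens := (@tens k V W).
Local Notation tsum := (@tsum k V W _).
Local Notation tens_rel := (@tens_rel k V W).

Lemma tens_bilinear : bilinear tens.
Proof.
split=> [w a v v'|v a w w']; rewrite unlock -linearP; apply/lquot_piP.
  by apply: sub_gen_smallest; left; do 4!eexists; rewrite opprD addrA.
by apply: sub_gen_smallest; right; do 4!eexists; rewrite opprD addrA.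
Qed.

Section Universal.
Variables (X : lmodType k) (f : V -> W -> X).
Hypothesis fB : bilinear f.

Fact tsum_pi x : tsum f (lquot_pi tens_rel x) = lext (fun p => f p.1 p.2) x.
Proof.
rewrite unlock; apply/eqP; rewrite -subr_eq0 -linearB; apply/eqP.
pose K := [set y | lext (fun p => f p.1 p.2) y = 0].
suff sK : lspan tens_rel `<=` K.
  by apply: sK; apply/lquot_piP; rewrite lquot_reprK.
apply: smallest_sub => [|_ [[a [v [v' [w ->]]]]|[a [v [w [w' ->]]]]]].
- split=> [|a y z]; rewrite !inE /K /=; first by rewrite linear0.
  by move=> y0 z0; rewrite linearP /= y0 z0 scaler0 addr0.
- by rewrite /K /= !linearB linearZ /= !lextU /= (fB.1 w) -addrA -opprD subrr.
- by rewrite /K /= !linearB linearZ /= !lextU /= (fB.2 v) -addrA -opprD subrr.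
Qed.

Lemma tsum_linear : linear (tsum f).
Proof.
move=> a t u; rewrite -[t]lquot_reprK -[u]lquot_reprK -linearP !tsum_pi.
exact: linearP.
Qed.

Lemma tsum_tens v w : tsum f (tens v w) = f v w.
Proof. by rewrite tens.unlock tsum_pi lextU. Qed.

End Universal.

Lemma tensor_ind (P : tensor -> Prop) :
  P 0 -> (forall a v w t, P t -> P (a *: tens v w + t)) -> forall t, P t.
Proof.
move=> P0 PD t; rewrite -[t]lquot_reprK [lquot_repr t]monalgE linear_sum /=.
elim: (enum_fset _) => [|[v w] s IH]; first by rewrite big_nil.
rewrite big_cons; set c := mcoeff _ _.
suff -> : lquot_pi tens_rel << c *g (v, w) >> = c *: tens v w by exact: PD.
rewrite tens.unlock -linearZ /=; congr lquot_pi.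
by apply/malgP => j; rewrite mcoeffZ !mcoeffU mulr_natr.
Qed.

End TensorTheory.

Notation "V ⊗ W" := (tensor V W) (at level 40, left associativity) : type_scope.
Notation "v ⊗ w" := (tens v w) (at level 40, left associativity) : ring_scope.
Notation "\tsum_ ( v , w <- t ) F" := (tsum (fun v w => F) t)
  (at level 41, F at level 41, v name, w name, t at level 99,
   format "\tsum_ ( v ,  w  <-  t )  F") : ring_scope.

(** * Coalgebras, bialgebras, Hopf algebras

    The records [coalgData] and [bialgData] carry structure maps only; the
    axioms are the predicates [is_coalgebra], [is_algebra], ... *)

Record coalgData (k : fieldType) := CoalgData {
  csort :> lmodType k;
  comul : csort -> (csort ⊗ csort)%type;
  counit : csort -> k
}.

Definition is_coalgebra (k : fieldType) (C : coalgData k) : Prop :=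
  [/\ linear (@comul k C), scalar (@counit k C),
      forall c : C,
        \tsum_(c1, c2 <- comul c) \tsum_(c11, c12 <- comul c1)
          c11 ⊗ (c12 ⊗ c2) =
        \tsum_(c1, c2 <- comul c) \tsum_(c21, c22 <- comul c2)
          c1 ⊗ (c21 ⊗ c22),
      forall c : C, \tsum_(c1, c2 <- comul c) counit c1 *: c2 = c &
      forall c : C, \tsum_(c1, c2 <- comul c) counit c2 *: c1 = c].

Definition coalg_iso (k : fieldType) (C D : coalgData k) : Prop :=
  exists f : C -> D,
    [/\ linear f, bijective f,
        forall c, comul (f c) = \tsum_(c1, c2 <- comul c) f c1 ⊗ f c2 &
        forall c, counit (f c) = counit c].

Definition is_subcoalgebra (k : fieldType) (C : coalgData k) (D : set C) : Prop :=
  submod_closed (mem D) /\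
  (forall c, D c -> lspan [set x ⊗ y | x in D & y in D] (comul c)).

Definition is_simple_subcoalgebra (k : fieldType) (C : coalgData k)
    (D : set C) : Prop :=
  [/\ is_subcoalgebra D, D <> [set 0] &
      forall E : set C, is_subcoalgebra E -> E `<=` D -> E = [set 0] \/ E = D].

Definition cosemisimple (k : fieldType) (C : coalgData k) : Prop :=
  lspan (\bigcup_(D in @is_simple_subcoalgebra k C) D) = setT.

Record bialgData (k : fieldType) := BialgData {
  bcoalg :> coalgData k;
  bmul : bcoalg -> bcoalg -> bcoalg;
  bone : bcoalg
}.

Section Hopf.
Variables (k : fieldType) (A : bialgData k).

Local Notation "x ∙ y" := (bmul x y) (at level 40, left associativity).

Definition is_algebra : Prop :=
  [/\ bilinear (@bmul k A), associative (@bmul k A),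
      left_id (bone A) (@bmul k A) & right_id (bone A) (@bmul k A)].

Definition counit_multiplicative : Prop :=
  counit (bone A) = 1 /\
  forall a b : A, counit (a ∙ b) = counit a * counit b.

Definition is_bialgebra : Prop :=
  [/\ is_algebra, is_coalgebra A, counit_multiplicative,
      comul (bone A) = bone A ⊗ bone A &
      forall a b : A, comul (a ∙ b) =
        \tsum_(a1, a2 <- comul a) \tsum_(b1, b2 <- comul b)
          (a1 ∙ b1) ⊗ (a2 ∙ b2)].

Definition is_antipode (S : A -> A) : Prop :=
  [/\ linear S,
      forall a : A, \tsum_(a1, a2 <- comul a) S a1 ∙ a2 = counit a *: bone A &
      forall a : A, \tsum_(a1, a2 <- comul a) a1 ∙ S a2 = counit a *: bone A].

Definition is_hopf (S : A -> A) : Prop := is_bialgebra /\ is_antipode S.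

End Hopf.
Arguments is_antipode {k} A S.
Arguments is_hopf {k} A S.

(** * Yetter-Drinfeld modules and the biproduct *)

Record ydData (k : fieldType) (H : bialgData k) := YdData {
  ysort :> lmodType k;
  yact : H -> ysort -> ysort;
  ycoact : ysort -> (H ⊗ ysort)%type
}.

Section YetterDrinfeld.
Variables (k : fieldType) (H : bialgData k).
Implicit Types M N : ydData H.

Local Notation "x ∙ y" := (bmul x y) (at level 40, left associativity).
Local Notation "h ▷ m" := (yact h m) (at level 38, right associativity).
Local Notation Δ := (@comul k _).
Local Notation ρ := (@ycoact k H _).

Definition is_module M : Prop :=
  [/\ bilinear (@yact k H M), forall m : M, bone H ▷ m = m &
      forall (h h' : H) (m : M), (h ∙ h') ▷ m = h ▷ h' ▷ m].

Definition is_comodule M : Prop :=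
  [/\ linear (@ycoact k H M),
      forall m : M,
        \tsum_(h, m0 <- ρ m) \tsum_(h1, h2 <- Δ h) h1 ⊗ (h2 ⊗ m0) =
        \tsum_(h, m0 <- ρ m) \tsum_(h', m00 <- ρ m0) h ⊗ (h' ⊗ m00) &
      forall m : M, \tsum_(h, m0 <- ρ m) counit h *: m0 = m].

Definition is_yd M : Prop :=
  [/\ is_module M, is_comodule M &
      forall (h : H) (m : M),
        \tsum_(h1, h2 <- Δ h) \tsum_(l, m0 <- ρ m) (h1 ∙ l) ⊗ (h2 ▷ m0) =
        \tsum_(h1, h2 <- Δ h) \tsum_(l, m0 <- ρ (h1 ▷ m)) (l ∙ h2) ⊗ m0].

Definition is_yd_morphism M N (f : M -> N) : Prop :=
  [/\ linear f, forall (h : H) (m : M), f (h ▷ m) = h ▷ f m &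
      forall m : M, ρ (f m) = \tsum_(l, m0 <- ρ m) l ⊗ f m0].

Definition yd_tensor M N : ydData H := @YdData k H (M ⊗ N)%type
  (fun h t => \tsum_(m, n <- t) \tsum_(h1, h2 <- Δ h) (h1 ▷ m) ⊗ (h2 ▷ n))
  (fun t => \tsum_(m, n <- t) \tsum_(l, m0 <- ρ m) \tsum_(l', n0 <- ρ n)
     (l ∙ l') ⊗ (m0 ⊗ n0)).

Definition yd_unit : ydData H := @YdData k H k^o
  (fun h a => counit h *: a) (fun a => bone H ⊗ a).

Section YDHopf.
Variables (B : bialgData k) (act : H -> B -> B) (coact : B -> (H ⊗ B)%type).

Let M : ydData H := YdData act coact.

Definition is_yd_hopf (S : B -> B) : Prop :=
  [/\ is_yd M,
      is_algebra B /\ is_coalgebra B,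
      [/\ @is_yd_morphism (yd_tensor M M) M (fun t => \tsum_(a, b <- t) a ∙ b),
          @is_yd_morphism yd_unit M (fun c => c *: bone B),
          @is_yd_morphism M (yd_tensor M M) Δ,
          @is_yd_morphism M yd_unit (@counit k B) &
          @is_yd_morphism M M S],
      [/\ counit_multiplicative B, Δ (bone B) = bone B ⊗ bone B &
          forall a b : B, Δ (a ∙ b) =
            \tsum_(a1, a2 <- Δ a) \tsum_(b1, b2 <- Δ b)
            \tsum_(l, a20 <- coact a2) (a1 ∙ act l b1) ⊗ (a20 ∙ b2)] &
      is_antipode B S].

Definition biprod_mul (x y : (B ⊗ H)%type) : (B ⊗ H)%type :=
  \tsum_(b, h <- x) \tsum_(b', h' <- y) \tsum_(h1, h2 <- Δ h)
    (b ∙ act h1 b') ⊗ (h2 ∙ h').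

Definition biprod_comul (x : (B ⊗ H)%type) : (B ⊗ H ⊗ (B ⊗ H))%type :=
  \tsum_(b, h <- x) \tsum_(b1, b2 <- Δ b) \tsum_(l, b20 <- coact b2)
  \tsum_(h1, h2 <- Δ h) (b1 ⊗ (l ∙ h1)) ⊗ (b20 ⊗ h2).

Definition biprod_counit (x : (B ⊗ H)%type) : k :=
  @tsum k B H k^o (fun b h => counit b * counit h) x.

Definition biproduct : bialgData k :=
  @BialgData k (@CoalgData k (B ⊗ H)%type biprod_comul biprod_counit)
    biprod_mul (bone B ⊗ bone H).

End YDHopf.
End YetterDrinfeld.

(** * Direct sums of coalgebras and comatrix coalgebras *)

Section DirectProduct.
Variables (k : fieldType) (I : Type) (V : I -> lmodType k).

Definition dprod : Type := forall i, V i.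

HB.instance Definition _ := Choice.on dprod.

Definition dprod_zero : dprod := fun=> 0.
Definition dprod_opp (f : dprod) : dprod := fun i => - f i.
Definition dprod_add (f g : dprod) : dprod := fun i => f i + g i.
Definition dprod_scale (a : k) (f : dprod) : dprod := fun i => a *: f i.

Fact dprod_addA : associative dprod_add.
Proof. by move=> f g h; apply: functional_extensionality_dep => i; exact: addrA. Qed.
Fact dprod_addC : commutative dprod_add.
Proof. by move=> f g; apply: functional_extensionality_dep => i; exact: addrC. Qed.
Fact dprod_add0 : left_id dprod_zero dprod_add.
Proof. by move=> f; apply: functional_extensionality_dep => i; exact: add0r. Qed.
Fact dprod_addN : left_inverse dprod_zero dprod_opp dprod_add.
Proof. by move=> f; apply: functional_extensionality_dep => i; exact: addNr. Qed.

HB.instance Definition _ := GRing.isZmodule.Build dprod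
  dprod_addA dprod_addC dprod_add0 dprod_addN.

Fact dprod_scaleA a b f : dprod_scale a (dprod_scale b f) = dprod_scale (a * b) f.
Proof. by apply: functional_extensionality_dep => i; exact: scalerA. Qed.
Fact dprod_scale1 : left_id 1 dprod_scale.
Proof. by move=> f; apply: functional_extensionality_dep => i; exact: scale1r. Qed.
Fact dprod_scaleDr : right_distributive dprod_scale +%R.
Proof. by move=> a f g; apply: functional_extensionality_dep => i; exact: scalerDr. Qed.
Fact dprod_scaleDl f : {morph dprod_scale^~ f : a b / a + b}.
Proof. by move=> a b; apply: functional_extensionality_dep => i; exact: scalerDl. Qed.

HB.instance Definition _ := GRing.Zmodule_isLmodule.Build k dprod
  dprod_scaleA dprod_scale1 dprod_scaleDr dprod_scaleDl.

Definition dsupp (f : dprod) : set I := [set i | f i != 0].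

Definition fin_dsupp : {pred dprod} := [pred f | `[< finite_set (dsupp f) >]].

Fact fin_dsupp_submod : submod_closed fin_dsupp.
Proof.
split=> [|a f g]; rewrite !unfold_in /=.
  apply/asboolP.
  by apply: (sub_finite_set _ (finite_set0 I)) => i; rewrite /dsupp /= eqxx.
move=> /asboolP ff /asboolP fg; apply/asboolP.
have: finite_set (dsupp f `|` dsupp g) by rewrite finite_setU.
apply: sub_finite_set => i /=; rewrite /dsupp /=.
have -> : (a *: f + g) i = a *: f i + g i by [].
by apply: contraPP => /not_orP[/negP/negPn/eqP-> /negP/negPn/eqP->];
  rewrite scaler0 addr0 eqxx.
Qed.

HB.instance Definition _ := GRing.isSubmodClosed.Build k dprod fin_dsupp
  (GRing.submod_closed_semi fin_dsupp_submod).

Record dsum := Dsum { dsum_val : dprod; _ : dsum_val \in fin_dsupp }.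

HB.instance Definition _ := [isSub for dsum_val].
HB.instance Definition _ := [Choice of dsum by <:].
HB.instance Definition _ := [SubChoice_isSubLmodule of dsum by <:].

End DirectProduct.

Section DirectSum.
Variables (k : fieldType) (I : choiceType).

Section Injection.
Variable V : I -> lmodType k.

Fact dsum_in_subproof i (v : V i) :
  (dfwith (fun j => 0 : V j) v : dprod V) \in @fin_dsupp k I V.
Proof.
rewrite unfold_in /=; apply/asboolP; apply: (sub_finite_set _ (finite_set1 i)) => j.
rewrite /dsupp /=; case: dfwithP => [//|j' _]; by rewrite eqxx.
Qed.

Definition dsum_in i (v : V i) : dsum V := Dsum (dsum_in_subproof v).

End Injection.

Variable C : I -> coalgData k.

Definition dsum_comul (x : dsum C) : (dsum C ⊗ dsum C)%type :=
  \sum_(i \in dsupp (dsum_val x)) \tsum_(c1, c2 <- comul (dsum_val x i))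
    dsum_in (V := C) (i := i) c1 ⊗ dsum_in (V := C) (i := i) c2.

Definition dsum_counit (x : dsum C) : k :=
  \sum_(i \in dsupp (dsum_val x)) counit (dsum_val x i).

Definition dsum_coalg : coalgData k :=
  @CoalgData k (dsum C) dsum_comul dsum_counit.

End DirectSum.

(** [copies X C] is [m · C] for the cardinal [m] of [X]. *)
Definition copies (k : fieldType) (X : choiceType) (C : coalgData k) :=
  dsum_coalg (fun _ : X => C).

Definition comatrix_coalg (k : fieldType) (r : nat) : coalgData k :=
  @CoalgData k {malg k[('I_r * 'I_r)%type]}
    (lext (fun p => \sum_(l < r) << (p.1, l) >> ⊗ << (l, p.2) >>))
    (lext (fun p => (p.1 == p.2)%:R : k^o)).

(** * Groups *)

Definition is_subgroup (G : groupType) (S : set G) : Prop := group_closed (mem S).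

Definition generated (G : groupType) (X : set G) : set G :=
  smallest (@is_subgroup G) X.

Definition gcenter (G : groupType) : set G := [set z | forall g : G, commute z g].
Arguments gcenter G : clear implicits.

Definition lcosets (G : groupType) (S : set G) : set (set G) :=
  [set [set (g * s)%g | s in S] | g in [set: G]].

Section Automorphisms.
Variable G : groupType.

Definition is_automorphism (f : G -> G) : Prop :=
  {morph f : x y / (x * y)%g} /\ bijective f.

Record grp_aut := GrpAut {
  aut_fun :> G -> G;
  aut_funP : `[< is_automorphism aut_fun >]
}.

HB.instance Definition _ := [isSub for aut_fun].
HB.instance Definition _ := [Choice of grp_aut by <:].

Fact aut_surj (f : grp_aut) y : exists x, f x = y.
Proof. by have /asboolP[_ [g _ fg]] := aut_funP f; exists (g y). Qed.

Definition aut_inv_fun (f : grp_aut) (y : G) : G := projT1 (cid (aut_surj f y)).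

Fact aut_inv_funK (f : grp_aut) : cancel (aut_inv_fun f) f.
Proof. by move=> y; rewrite /aut_inv_fun; case: cid. Qed.

Fact aut_fun_inj (f : grp_aut) : injective f.
Proof. by have /asboolP[_ /bij_inj] := aut_funP f. Qed.

Fact aut_funK (f : grp_aut) : cancel f (aut_inv_fun f).
Proof. by move=> x; apply: (@aut_fun_inj f); rewrite aut_inv_funK. Qed.

Lemma aut_funM (f : grp_aut) : {morph f : x y / (x * y)%g}.
Proof. by have /asboolP[] := aut_funP f. Qed.

Fact aut_one_subproof : `[< is_automorphism (@id G) >].
Proof. by apply/asboolP; split=> //; exists id. Qed.

Fact aut_mul_subproof (f g : grp_aut) : `[< is_automorphism (f \o g) >].
Proof.
apply/asboolP; split=> [x y|]; first by rewrite /= !aut_funM.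
by apply: bij_comp; [have /asboolP[] := aut_funP f|have /asboolP[] := aut_funP g].
Qed.

Fact aut_inv_subproof (f : grp_aut) : `[< is_automorphism (aut_inv_fun f) >].
Proof.
apply/asboolP; split=> [x y|].
  by apply: (@aut_fun_inj f); rewrite aut_funM !aut_inv_funK.
by exists f; [exact: aut_inv_funK|exact: aut_funK].
Qed.

Definition aut_one := GrpAut aut_one_subproof.
Definition aut_mul f g := GrpAut (aut_mul_subproof f g).
Definition aut_inv f := GrpAut (aut_inv_subproof f).

Fact aut_mulA : associative aut_mul.
Proof. by move=> f g h; apply: val_inj. Qed.
Fact aut_mul1 : left_id aut_one aut_mul.
Proof. by move=> f; apply: val_inj. Qed.
Fact aut_mulr1 : right_id aut_one aut_mul.
Proof. by move=> f; apply: val_inj. Qed.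
Fact aut_mulV : left_inverse aut_one aut_inv aut_mul.
Proof. by move=> f; apply: val_inj; apply: funext => x /=; rewrite aut_funK. Qed.
Fact aut_mulrV : right_inverse aut_one aut_inv aut_mul.
Proof. by move=> f; apply: val_inj; apply: funext => x /=; rewrite aut_inv_funK. Qed.

HB.instance Definition _ := isGroup.Build grp_aut
  aut_mulA aut_mul1 aut_mulr1 aut_mulV aut_mulrV.

Definition aut_orbit (f : grp_aut) (x : G) : set G :=
  [set s x | s in generated [set f]].

Definition aut_orbits (f : grp_aut) : set (set G) := range (aut_orbit f).

End Automorphisms.

Section FieldUnits.
Variable k : fieldType.

Record kunits := KUnit { kunit_val : k; kunitP : kunit_val != 0 }.

HB.instance Definition _ := [isSub for kunit_val].
HB.instance Definition _ := [Choice of kunits by <:].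

Fact kunits_mul_subproof (u v : kunits) : kunit_val u * kunit_val v != 0.
Proof. by rewrite mulf_neq0 ?kunitP. Qed.
Fact kunits_inv_subproof (u : kunits) : (kunit_val u)^-1 != 0.
Proof. by rewrite invr_neq0 ?kunitP. Qed.

Definition kunits_one := KUnit (oner_neq0 k).
Definition kunits_mul u v := KUnit (kunits_mul_subproof u v).
Definition kunits_inv u := KUnit (kunits_inv_subproof u).

Fact kunits_mulA : associative kunits_mul.
Proof. by move=> u v w; apply: val_inj; rewrite /= mulrA. Qed.
Fact kunits_mul1 : left_id kunits_one kunits_mul.
Proof. by move=> u; apply: val_inj; rewrite /= mul1r. Qed.
Fact kunits_mulr1 : right_id kunits_one kunits_mul.
Proof. by move=> u; apply: val_inj; rewrite /= mulr1. Qed.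
Fact kunits_mulV : left_inverse kunits_one kunits_inv kunits_mul.
Proof. by move=> u; apply: val_inj; rewrite /= mulVf ?kunitP. Qed.
Fact kunits_mulrV : right_inverse kunits_one kunits_inv kunits_mul.
Proof. by move=> u; apply: val_inj; rewrite /= mulfV ?kunitP. Qed.

HB.instance Definition _ := isGroup.Build kunits
  kunits_mulA kunits_mul1 kunits_mulr1 kunits_mulV kunits_mulrV.

End FieldUnits.

Definition subgroups_of_order (G : groupType) (S : set G) (r : nat) :
    set (set G) :=
  [set T | [/\ is_subgroup T, T `<=` S & T #= `I_r]].

(** The subgroup [S_r] of [S] of order [r]; meaningful only when [S] has
    exactly one such subgroup. *)
Definition subgroup_of_order (G : groupType) (S : set G) (r : nat) : set G :=
  get (subgroups_of_order S r).

(** * Eigenspaces *)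

Section Eigen.
Variables (k : fieldType) (V : lmodType k) (f : V -> V).

Definition eigenspace (a : k) : set V := [set v | f v = a *: v].

Definition eigenvalue (a : k) : Prop := exists2 v, eigenspace a v & v != 0.

Definition diagonalizable : Prop := lspan (\bigcup_a eigenspace a) = setT.

End Eigen.

(** * Group algebras *)

Section GroupAlgebra.
Variables (k : fieldType) (G : groupType).

Definition galg_mul (x y : {malg k[G]}) : {malg k[G]} :=
  lext (fun g => lext (fun h => << (g * h)%g >>) y) x.

Definition galg : bialgData k :=
  @BialgData k
    (@CoalgData k {malg k[G]} (lext (fun g => << g >> ⊗ << g >>))
       (lext (fun=> 1 : k^o)))
    galg_mul << 1%g >>.

Definition galg_antipode : galg -> galg := lext (fun g => << (g^-1)%g >>).

Definition galg_map (f : G -> G) : galg -> galg := lext (fun g => << f g >>).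

End GroupAlgebra.

Section AutAction.
Variables (k : fieldType) (G GG : groupType) (pi : G -> grp_aut GG).

Definition galg_act (h : galg k G) (b : galg k GG) : galg k GG :=
  lext (fun g => galg_map (pi g) b) h.

End AutAction.

(* Main.v *)
Require Import Defs.
From HB Require Import structures.
From mathcomp Require Import all_boot ssralg.
From mathcomp Require Import finmap.
From mathcomp Require Import boolp classical_sets functions cardinality.
From mathcomp Require Import fsbigop.
From mathcomp.multinomials Require Import monalg.
From mathcomp Require Import poly polydiv.
From mathcomp Require cyclic.

Set Implicit Arguments.
Unset Strict Implicit.
Unset Printing Implicit Defensive.

Import GRing.Theory.

Local Open Scope ring_scope.
Local Open Scope classical_set_scope.

(** Group-like elements make everything explicit.  Let [x] be a point of [GG]
    whose [theta]-orbit has length [r].  A sum of eigenvectors is killed by a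
    product of distinct linear factors in [theta]; as the translates of [x] are
    linearly independent, [X^r - 1] divides such a product, so [k] contains a
    primitive [r]-th root of unity [z] ([diagonalizable_prim_root]).  The powers
    of [z] are eigenvalues ([unity_root_eigenvalue]), hence belong to [U], and
    the powers of [u = bold z] form the subgroup of [bU] of order [r]
    ([subgroup_of_orderE]).

    The coaction exists because the eigenspaces are independent
    ([linear_by_eigenspaces]).  Decomposing [x] into eigenvectors gives it on the
    translates [x_a] of [x]: [rho x_a] is the sum over [b] of
    [f_ab] tensor [x_b], where [f_ab = r^-1 * sum_j (z^a / z^b)^j u^j]
    ([orbit_coaction]).  For fixed [a] the [f_ab] are the orthogonal idempotents
    of the group algebra of the cyclic group generated by [u]
    ([cyclic_coef_mul]), and the coproduct of [f_ab] is the sum over [c] of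
    [f_ac] tensor [f_cb] ([cyclic_coef_comul]).

    The conditions that involve the coaction are linear in the elements of [B],
    and most of them are checked on eigenvectors ([eigen_ext]), where they hold
    because [theta] is an automorphism commuting with the action and [bU] is
    central and acts trivially.  The colinearity of the coproduct of [B] is
    checked on group elements instead, where it is the orthogonality of the
    [f_ab] ([yd_comul_morphism]).  The multiplication and the antipode of the
    biproduct are again verified on eigenvectors ([biprod_bialgebra],
    [biprod_is_antipode], [biprod_antipodeK]).

    As a coalgebra the biproduct decomposes because, for [g] in [G], the elements
    [e_ab = x_a] tensor [f_ab g] satisfy the comatrix formulas: in the coproduct
    of [e_ab] the orthogonality of the [f_ab] collapses a double sum to the sum
    over [p] of [e_ap] tensor [e_pb] ([biprod_entry_family]).  By Fourier
    inversion the [e_ab], with [x] ranging over representatives of the orbits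
    and [g] over representatives of the cosets of the subgroup generated by [u],
    form a basis ([block_decomposition]).  This gives the coalgebra axioms
    ([comatrix_coalgebra]), the isomorphism with a direct sum of comatrix
    coalgebras ([biprod_decomposition]), and cosemisimplicity, a linearly
    independent comatrix family spanning a simple subcoalgebra
    ([comatrix_family_simple]). *)

(** * Linear maps out of tensor products and free modules *)

Section LinearMaps.
Variable k : fieldType.
Implicit Types U V W X : lmodType k.

(** Linearity is a proposition here, while the lemmas on sums and scaling are
    stated for the packed structure. *)
Definition linear_of U V (f : U -> V) (fL : linear f) : {linear U -> V} :=
  HB.pack f (GRing.isLinear.Build k U V *:%R f fL).

Lemma lin0 U V (f : U -> V) : linear f -> f 0 = 0.
Proof. by move=> fL; exact: (linear0 (linear_of fL)). Qed.

Lemma linD U V (f : U -> V) : linear f -> {morph f : x y / x + y}.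
Proof. by move=> fL; exact: (linearD (linear_of fL)). Qed.

Lemma linZ U V (f : U -> V) : linear f -> forall a x, f (a *: x) = a *: f x.
Proof. by move=> fL a x; exact: (linearZZ (linear_of fL)). Qed.

Lemma linS U V (f : U -> V) : linear f ->
  forall (I : Type) (r : seq I) P (F : I -> U),
  f (\sum_(i <- r | P i) F i) = \sum_(i <- r | P i) f (F i).
Proof. by move=> fL I r P F; exact: (linear_sum (linear_of fL)). Qed.

Lemma linear_id U : linear (fun x : U => x).
Proof. by []. Qed.

Lemma linear_comp U V W (f : V -> W) (A : U -> V) :
  linear f -> linear A -> linear (fun x => f (A x)).
Proof. by move=> fL AL a x y; rewrite AL fL. Qed.

Lemma linear_add U V (A B : U -> V) :
  linear A -> linear B -> linear (fun x => A x + B x).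
Proof. by move=> AL BL a x y; rewrite AL BL scalerDr addrACA. Qed.

Lemma linear_zero U V : linear (fun _ : U => 0 : V).
Proof. by move=> a x y; rewrite scaler0 addr0. Qed.

Lemma linear_bigsum U V (I : Type) (r : seq I) P (A : I -> U -> V) :
  (forall i, linear (A i)) -> linear (fun x => \sum_(i <- r | P i) A i x).
Proof.
move=> AL a x y; rewrite scaler_sumr -big_split; apply: eq_bigr => i _.
exact: AL.
Qed.

Lemma linear_scale U V a (A : U -> V) : linear A -> linear (fun x => a *: A x).
Proof. by move=> AL b x y; rewrite AL scalerDr !scalerA mulrC. Qed.

Lemma linear_scalel U V (A : U -> k^o) (v : V) :
  linear A -> linear (fun x => (A x : k) *: v).
Proof. by move=> AL b x y; rewrite AL scalerDl scalerA. Qed.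

Lemma linear_tensl U V W (A : U -> V) (w : W) :
  linear A -> linear (fun x => A x ⊗ w).
Proof. exact: (linear_comp ((tens_bilinear V W).1 w)). Qed.

Lemma linear_tensr U V W (A : U -> W) (v : V) :
  linear A -> linear (fun x => v ⊗ A x).
Proof. exact: (linear_comp ((tens_bilinear V W).2 v)). Qed.

Lemma linear_tsum U V W X (f : V -> W -> X) (A : U -> (V ⊗ W)%type) :
  bilinear f -> linear A -> linear (fun x => tsum f (A x)).
Proof. by move=> fB; exact: (linear_comp (tsum_linear fB)). Qed.

Lemma linear_lext U (K : choiceType) V (f : K -> V) (A : U -> {malg k[K]}) :
  linear A -> linear (fun x => lext f (A x)).
Proof. exact: (linear_comp (lext_is_linear f)). Qed.

Lemma linear_lext_param U (K : choiceType) V (F : U -> K -> V) b :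
  (forall i, linear (fun x => F x i)) -> linear (fun x => lext (F x) b).
Proof.
move=> FL a x y; rewrite !lextE scaler_sumr -big_split; apply: eq_bigr => i _.
by rewrite FL scalerDr !scalerA mulrC.
Qed.

(** A Sweedler sum is linear in a parameter of its summand as soon as the
    summand is, because it is evaluated on a representative that does not depend
    on the parameter. *)
Lemma linear_tsum_param U V W X (F : U -> V -> W -> X) t :
  (forall v w, linear (fun x => F x v w)) -> linear (fun x => tsum (F x) t).
Proof.
move=> FL a x y; rewrite !tsum.unlock.
exact: (linear_lext_param (F := fun x p => F x p.1 p.2)).
Qed.

Lemma tens_ext V W X (f g : (V ⊗ W)%type -> X) : linear f -> linear g ->
  (forall v w, f (v ⊗ w) = g (v ⊗ w)) -> forall t, f t = g t.
Proof.
move=> fL gL fg; apply: tensor_ind => [|a v w t IH].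
  by rewrite (lin0 fL) (lin0 gL).
by rewrite fL gL IH fg.
Qed.

Lemma malg_ext (K : choiceType) V (f g : {malg k[K]} -> V) :
  linear f -> linear g -> (forall x, f << x >> = g << x >>) ->
  forall b, f b = g b.
Proof.
move=> fL gL fg b; rewrite [b]monalgE (linS fL) (linS gL).
apply: eq_bigr => i _.
have -> : << b@_i *g i >> = b@_i *: << i >> :> {malg k[K]}.
  by apply/malgP => j; rewrite mcoeffZ !mcoeffU mulr_natr.
by rewrite (linZ fL) (linZ gL) fg.
Qed.

Lemma tens_malg_ext (K L : choiceType) X
    (f g : ({malg k[K]} ⊗ {malg k[L]})%type -> X) : linear f -> linear g ->
  (forall x y, f (<< x >> ⊗ << y >>) = g (<< x >> ⊗ << y >>)) ->
  forall t, f t = g t.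
Proof.
move=> fL gL fg; apply: tens_ext => // v w.
apply: (malg_ext (f := fun v => f (v ⊗ w)) (g := fun v => g (v ⊗ w))) v.
- by apply: linear_comp => //; apply: linear_tensl; exact: linear_id.
- by apply: linear_comp => //; apply: linear_tensl; exact: linear_id.
move=> x.
apply: (malg_ext (f := fun w => f (<< x >> ⊗ w))
  (g := fun w => g (<< x >> ⊗ w))) w => //.
- by apply: linear_comp => //; apply: linear_tensr; exact: linear_id.
- by apply: linear_comp => //; apply: linear_tensr; exact: linear_id.
Qed.

Lemma lspan_ext V X (S : set V) (f g : V -> X) : linear f -> linear g ->
  (forall v, S v -> f v = g v) -> forall v, lspan S v -> f v = g v.
Proof.
move=> fL gL fg; apply: smallest_sub => // ; split.
  by rewrite inE /= (lin0 fL) (lin0 gL).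
by move=> a x y; rewrite !inE /= => xE yE; rewrite fL gL xE yE.
Qed.

Lemma lquot_pi_linear V (S : set V) : linear (lquot_pi S).
Proof. by move=> a x y; exact: linearP. Qed.

(** Reduces a spanning statement to the equality of two linear maps, so that the
    extension lemmas above apply. *)
Lemma lspan_full V (S : set V) : (forall v, lquot_pi S v = 0) -> lspan S = setT.
Proof.
move=> S0; apply/seteqP; split=> // v _.
rewrite -[v]subr0; apply/lquot_piP; rewrite S0.
by rewrite (lin0 (lquot_pi_linear S)).
Qed.

Lemma lquot_pi_span V (S : set V) v : lspan S v -> lquot_pi S v = 0.
Proof.
move=> vS; rewrite -(lin0 (lquot_pi_linear S)); apply/lquot_piP.
by rewrite subr0.
Qed.

Lemma tens_suml V W I (r : seq I) P (F : I -> V) (w : W) :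
  (\sum_(i <- r | P i) F i) ⊗ w = \sum_(i <- r | P i) F i ⊗ w.
Proof. exact: (linS ((tens_bilinear V W).1 w)). Qed.

Lemma tens_sumr V W I (r : seq I) P (F : I -> W) (v : V) :
  v ⊗ (\sum_(i <- r | P i) F i) = \sum_(i <- r | P i) v ⊗ F i.
Proof. exact: (linS ((tens_bilinear V W).2 v)). Qed.

Lemma tens_scalel V W a (v : V) (w : W) : (a *: v) ⊗ w = a *: (v ⊗ w).
Proof. exact: (linZ ((tens_bilinear V W).1 w)). Qed.

Lemma tens_scaler V W a (v : V) (w : W) : v ⊗ (a *: w) = a *: (v ⊗ w).
Proof. exact: (linZ ((tens_bilinear V W).2 v)). Qed.

Lemma tsum_sum V W X (f : V -> W -> X) : bilinear f ->
  forall I (r : seq I) P (F : I -> (V ⊗ W)%type),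
  tsum f (\sum_(i <- r | P i) F i) = \sum_(i <- r | P i) tsum f (F i).
Proof. by move=> fB; exact: (linS (tsum_linear fB)). Qed.

Lemma tsum_sum_tens V W X (f : V -> W -> X) : bilinear f ->
  forall I (r : seq I) P (v : I -> V) (w : I -> W),
  tsum f (\sum_(i <- r | P i) v i ⊗ w i) = \sum_(i <- r | P i) f (v i) (w i).
Proof.
move=> fB I r P v w; rewrite (tsum_sum fB); apply: eq_bigr => i _.
exact: tsum_tens.
Qed.

(** Only [f] has to be bilinear: both sides expand the same representative of
    [t]. *)
Lemma tsum_tsum V W V' W' X (f : V' -> W' -> X) (v' : V -> W -> V')
    (w' : V -> W -> W') t : bilinear f ->
  tsum f (\tsum_(v, w <- t) v' v w ⊗ w' v w) =
    \tsum_(v, w <- t) f (v' v w) (w' v w).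
Proof.
have tsumE (Y : lmodType k) (g : V -> W -> Y) :
    tsum g t = lext (fun p => g p.1 p.2) (lquot_repr t) by rewrite tsum.unlock.
move=> fB; rewrite (tsumE _ (fun v w => v' v w ⊗ w' v w)).
rewrite (tsumE _ (fun v w => f (v' v w) (w' v w))) !lextE (tsum_sum fB).
apply: eq_bigr => i _.
by rewrite (linZ (tsum_linear fB)) tsum_tens.
Qed.

End LinearMaps.

(** The linearity facts that [lin] may use at its leaves, extended below as maps
    are introduced. *)
Ltac lin_base := fail.

(** A pattern variable below a binder may match a term that mentions the bound
    variable, so [lin] must test separately that a subterm is closed; this fails
    if it is not. *)
Ltac constant_value F :=
  lazymatch F with fun _ => ?w => constr:(w) end.

(** Proves that an explicit expression is linear in one variable, or bilinear,
    descending through tensors, sums and Sweedler sums; the linearity of other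
    maps is looked up in [lin_base] and in the context. *)
Ltac lin :=
  cbv beta;
  lazymatch goal with
  | |- bilinear _ => split=> ? /=; lin
  | |- forall _, _ => move=> ?; lin
  | |- GRing.linear_for _ (fun x => x) => refine (@linear_id _ _)
  | |- GRing.linear_for _ (fun x => 0) => refine (@linear_zero _ _ _)
  | |- GRing.linear_for _ (fun x => @tens _ _ _ (@?A x) (@?B x)) =>
      first [ let w := constant_value B in refine (linear_tensl (A := A) w _)
            | let v := constant_value A in refine (linear_tensr (A := B) v _) ];
      lin
  | |- GRing.linear_for _ (fun x => @tsum _ _ _ _ (@?F x) (@?A x)) =>
      first [ let t := constant_value A in
              refine (linear_tsum_param (F := F) t _)
            | let f := constant_value F in
              refine (linear_tsum (f := f) (A := A) _ _) ];
      lin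
  | |- GRing.linear_for _ (fun x => @lext _ _ _ (@?F x) (@?A x)) =>
      first [ let t := constant_value A in
              refine (linear_lext_param (F := F) t _)
            | let f := constant_value F in
              refine (linear_lext f (A := A) _) ];
      lin
  | |- GRing.linear_for _ (@lext _ _ _ _) => refine (@lext_is_linear _ _ _ _)
  | |- GRing.linear_for _ (@tsum _ _ _ _ _) => refine (tsum_linear _); lin
  | |- GRing.linear_for _ (fun x => @?A x + @?B x) =>
      refine (linear_add (A := A) (B := B) _ _); lin
  | |- GRing.linear_for _ (fun x => (@?F x) *: (@?A x)) =>
      first [ let a := constant_value F in refine (linear_scale a (A := A) _)
            | let v := constant_value A in refine (linear_scalel (A := F) v _) ];
      lin
  | |- GRing.linear_for _ (fun x => @bigop.body _ _ _ _ _) =>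
      apply: linear_bigsum => ?; lin
  | |- _ => first [lin_base | solve [auto with nocore] | lin_app]
  end
with lin_app :=
  first
  [ lazymatch goal with
    | |- GRing.linear_for _ (fun x => ?f (@?A x)) =>
        refine (linear_comp (f := f) (A := A) _ _)
    end
  | lazymatch goal with
    | |- GRing.linear_for _ (fun x => ?f (@?A x) (@?B x)) =>
        let b := constant_value B in
        refine (linear_comp (f := fun y => f y b) (A := A) _ _)
    end ];
  [first [lin_base | solve [auto with nocore]] | lin].

(** * Group algebras are Hopf algebras *)

Section GroupAlgebraTheory.
Variables (k : fieldType) (G : groupType).

Local Notation kG := (galg k G).
Implicit Types (g h : G) (x y : kG).

Lemma galg_mulU g h :
  galg_mul (<< g >> : kG) (<< h >> : kG) = << (g * h)%g >>.
Proof. by rewrite /galg_mul !lextU. Qed.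

Lemma galg_mull x : linear (galg_mul x).
Proof. by rewrite /galg_mul; lin. Qed.

Lemma galg_mulr y : linear (fun x => galg_mul x y).
Proof. by rewrite /galg_mul; lin. Qed.

Lemma galg_antipode_linear : linear (@galg_antipode k G).
Proof. exact: lext_is_linear. Qed.

Lemma galg_antipodeU g : galg_antipode (<< g >> : kG) = << (g^-1)%g >>.
Proof. by rewrite /galg_antipode lextU. Qed.

Lemma galg_antipodeK x : galg_antipode (galg_antipode x) = x.
Proof.
move: x; apply: malg_ext => [||g].
- exact: (linear_comp galg_antipode_linear galg_antipode_linear).
- exact: linear_id.
by rewrite !galg_antipodeU invgK.
Qed.

Lemma galg_map_linear f : linear (@galg_map k G f).
Proof. exact: lext_is_linear. Qed.

Lemma galg_mapU f g : galg_map f (<< g >> : kG) = << f g >>.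
Proof. by rewrite /galg_map lextU. Qed.

End GroupAlgebraTheory.

Ltac lin_base ::=
  first [ refine (galg_mull _) | refine (galg_mulr _)
        | refine (@galg_antipode_linear _ _) | refine (galg_map_linear _) ].

Section GroupAlgebraHopf.
Variables (k : fieldType) (G : groupType).

Local Notation kG := (galg k G).
Implicit Types (g h : G) (x y : kG).

Lemma galg_is_algebra : is_algebra kG.
Proof.
split=> [|x y z|x|x].
- by split=> x /=; lin.
- move: x; apply: malg_ext => /= [||g]; [lin|lin|].
  move: y; apply: malg_ext => /= [||h]; [lin|lin|].
  move: z; apply: malg_ext => /= [||l]; [lin|lin|].
  by rewrite !galg_mulU mulgA.
- by move: x; apply: malg_ext => /= [||g]; [lin|lin|rewrite galg_mulU mul1g].
- by move: x; apply: malg_ext => /= [||g]; [lin|lin|rewrite galg_mulU mulg1].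
Qed.

Lemma galg_comulU g : comul (<< g >> : kG) = (<< g >> : kG) ⊗ << g >>.
Proof. by rewrite /= lextU. Qed.

Lemma galg_counitU g : counit (<< g >> : kG) = 1.
Proof. by rewrite /= lextU. Qed.

Lemma galg_is_coalgebra : is_coalgebra kG.
Proof.
split=> [||x|x|x].
- exact: lext_is_linear.
- by move=> a x y; rewrite /= linearP.
- move: x; apply: malg_ext => /= [||g]; [lin|lin|].
  by rewrite !lextU !tsum_tens ?lextU ?tsum_tens //; lin.
- move: x; apply: malg_ext => /= [||g]; [lin|lin|].
  by rewrite !lextU !tsum_tens ?lextU ?scale1r //; lin.
- move: x; apply: malg_ext => /= [||g]; [lin|lin|].
  by rewrite !lextU !tsum_tens ?lextU ?scale1r //; lin.
Qed.

Lemma galg_counit_multiplicative : counit_multiplicative kG.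
Proof.
split=> [|x y]; first by rewrite galg_counitU.
move: x; apply: (malg_ext (V := k^o)) => /= [||g]; [lin| |].
  by move=> a u v; rewrite /= linearP mulrDl; congr (_ + _); exact/esym/mulrA.
rewrite lextU mul1r.
move: y; apply: (malg_ext (V := k^o)) => /= [||h]; [lin|lin|].
by rewrite galg_mulU !lextU.
Qed.

Lemma galg_is_antipode : is_antipode kG (@galg_antipode k G).
Proof.
split=> [|x|x]; first exact: galg_antipode_linear.
- move: x; apply: malg_ext => /= [||g]; [lin|lin|].
  by rewrite !lextU tsum_tens ?galg_antipodeU ?galg_mulU ?mulVg ?scale1r //; lin.
- move: x; apply: malg_ext => /= [||g]; [lin|lin|].
  by rewrite !lextU tsum_tens ?galg_antipodeU ?galg_mulU ?mulgV ?scale1r //; lin.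
Qed.

End GroupAlgebraHopf.

(** * Subgroups and finite orbits of an automorphism *)

Section Subgroups.
Variable G : groupType.
Implicit Types S X : set G.

Lemma subgroupP S : is_subgroup S <->
  S 1%g /\ forall x y, S x -> S y -> S (x / y)%g.
Proof.
split=> [[S1 SF]|[S1 SF]]; split=> [|x y]; rewrite ?inE //.
- by rewrite inE in S1.
- by move=> xS yS; have := SF x y; rewrite !inE; apply.
exact: SF.
Qed.

Lemma subgroup1 S : is_subgroup S -> S 1%g.
Proof. by case/subgroupP. Qed.

Lemma subgroupV S x : is_subgroup S -> S x -> S (x^-1)%g.
Proof. by case/subgroupP => S1 SF xS; rewrite -div1g; exact: SF. Qed.

Lemma subgroupM S x y : is_subgroup S -> S x -> S y -> S (x * y)%g.
Proof.
move=> SG xS yS; rewrite -[y]invgK; have [_ SF] := (subgroupP S).1 SG.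
by apply: SF => //; exact: subgroupV.
Qed.

Lemma subgroupX S x n : is_subgroup S -> S x -> S (x ^+ n)%g.
Proof.
move=> SG xS; elim: n => [|n IH]; first exact: subgroup1.
by rewrite expgS; exact: subgroupM.
Qed.

Lemma generated_subgroup X : is_subgroup (generated X).
Proof.
apply/subgroupP; split=> [S [SG _]|x y xX yX S SP]; first exact: subgroup1.
by have [_ SF] := (subgroupP S).1 SP.1; apply: SF; [exact: xX|exact: yX].
Qed.

Lemma sub_generated X : X `<=` generated X.
Proof. exact: sub_gen_smallest. Qed.

End Subgroups.

Section Orbits.
Variables (G : groupType) (f : grp_aut G).
Implicit Types (x y : G) (i j r : nat).

(** The orbit of [x] listed as the [r] distinct points [x], [f x], up to
    [f ^ (r - 1) x]. *)
Definition orbit_cycle x r : Prop :=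
  [/\ (0 < r)%N, iter r f x = x &
      forall i j, (i < r)%N -> (j < r)%N -> iter i f x = iter j f x -> i = j].

Lemma iter_aut_inj i : injective (iter i f).
Proof. by elim: i => [|i IH] x y //= /aut_fun_inj/IH. Qed.

Lemma aut_orbit_iter x i : aut_orbit f x (iter i f x).
Proof.
have fG := generated_subgroup [set f].
elim: i => [|i [s sf sE]].
  by exists 1%g => //; exact: subgroup1.
exists (f * s)%g; last by rewrite iterS -sE.
by apply: (subgroupM fG) => //; exact: sub_generated.
Qed.

Lemma aut_orbit_cycle x r : orbit_cycle x r ->
  aut_orbit f x = [set iter i f x | i in `I_r].
Proof.
move=> [r0 fr _]; apply/seteqP; split=> [y|_ [i _ <-]]; last first.
  exact: aut_orbit_iter.
pose A := [set iter i f x | i in `I_r].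
(* The automorphisms that permute the candidate orbit form a subgroup. *)
pose S := [set s : grp_aut G | forall y, A y <-> A (s y)].
suff gS : generated [set f] `<=` S.
  by move=> [s /gS sS <-]; apply: (sS x).1; exists 0%N.
apply: smallest_sub => [|_ ->].
  apply/subgroupP; split=> // s t sS tS z.
  have sz : (s / t)%g z = s (t^-1%g z) by [].
  have tz : t (t^-1%g z) = z by exact: aut_inv_funK.
  rewrite sz; split=> [zA|/(sS _).2/(tS _).1]; last by rewrite tz.
  by apply: (sS _).1; apply: (tS _).2; rewrite tz.
move=> z; split=> [[i ir <-]|[i ir zE]].
  have [ir1|ri] := ltnP i.+1 r; first by exists i.+1.
  by exists 0%N => //=; rewrite -{1}fr -iterS; congr iter; apply/eqP;
    rewrite eqn_leq ri.
case: i ir zE => [_|i ir] zE; last first.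
  by exists i => [|]; [exact: ltnW|apply: (@aut_fun_inj _ f)].
exists r.-1; first by rewrite /= prednK.
by apply: (@aut_fun_inj _ f); rewrite -iterS prednK // fr.
Qed.

Lemma card_orbit_cycle x r : orbit_cycle x r ->
  #|` fset_set (aut_orbit f x)| = r.
Proof.
move=> xr; apply: card_fset_set; rewrite (aut_orbit_cycle xr).
have [_ _ f_inj] := xr; apply: inj_card_eq => i j /set_mem ir /set_mem jr.
exact: f_inj.
Qed.

Lemma finite_orbit_cycle x : finite_set (aut_orbit f x) ->
  exists r, orbit_cycle x r.
Proof.
move=> fin.
have [r0 [r0_gt0 r0E]] : exists r, (0 < r)%N /\ iter r f x = x.
  apply: contrapT => no_r; apply: infinite_nat.
  have -> : [set: nat] = (fun i => iter i f x) @^-1` aut_orbit f x.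
    by apply/seteqP; split=> // i _; exact: aut_orbit_iter.
  have wlog_lt i j : (i < j)%N -> iter i f x = iter j f x -> False.
    move=> ij; rewrite -(subnKC (ltnW ij)) iterD => /iter_aut_inj/esym E.
    by apply: no_r; exists (j - i)%N; rewrite subn_gt0.
  apply: finite_preimage => // i j _ _ ijE.
  by case: (ltngtP i j) => // /wlog_lt; [case|move/(_ (esym ijE))].
have ex_r : exists r, (0 < r)%N && (iter r f x == x).
  by exists r0; rewrite r0_gt0 r0E /=.
case: (ex_minnP ex_r) => r /andP[r_gt0 /eqP rE] r_min; exists r; split=> //.
have wlog_lt i j : (i < j < r)%N -> iter i f x = iter j f x -> False.
  move=> /andP[ij jr]; rewrite -(subnKC (ltnW ij)) iterD.
  move=> /iter_aut_inj/esym/eqP E.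
  have := r_min (j - i)%N; rewrite subn_gt0 ij E => /(_ isT).
  by rewrite leqNgt (leq_ltn_trans (leq_subr _ _) jr).
move=> i j ir jr ijE; case: (ltngtP i j) => // [ij|ji].
  by case: (@wlog_lt i j); rewrite ?ij.
by case: (@wlog_lt j i); rewrite ?ji.
Qed.

Lemma orbit_cycle_iter x r i : orbit_cycle x r -> orbit_cycle (iter i f x) r.
Proof.
move=> [r0 fr inj]; split=> //; first by rewrite -iterD addnC iterD fr.
move=> a b ar br; rewrite -!iterD ![(_ + i)%N]addnC !iterD => /iter_aut_inj.
exact: inj.
Qed.

Lemma aut_orbit_same x r c : orbit_cycle x r -> (c < r)%N ->
  aut_orbit f (iter c f x) = aut_orbit f x.
Proof.
move=> xr cr; rewrite (aut_orbit_cycle (orbit_cycle_iter c xr)).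
apply/seteqP; split=> [_ [n _ <-]|].
  by rewrite -iterD; exact: aut_orbit_iter.
rewrite (aut_orbit_cycle xr) => _ [n nr <-].
(* Going [r - c] steps on from [f ^ c x] closes the cycle at [x]. *)
have := aut_orbit_iter (iter c f x) (n + (r - c)).
rewrite (aut_orbit_cycle (orbit_cycle_iter c xr)) -iterD -addnA (subnK (ltnW cr)).
by rewrite iterD; have [_ -> _] := xr.
Qed.

End Orbits.

(** * Diagonalizability and roots of unity *)

(** The value of a polynomial at the endomorphism [f]. *)
Section PolynomialAction.
Variables (k : fieldType) (V : lmodType k) (f : V -> V).
Hypothesis fL : linear f.
Implicit Types (p q : {poly k}) (v : V).

Definition polyact (p : {poly k}) (v : V) : V :=
  \sum_(i < size p) p`_i *: iter i f v.

Lemma iter_linear i : linear (iter i f).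
Proof. by elim: i => [|i IH] // a x y /=; rewrite IH fL. Qed.

Lemma polyactEw n p v : (size p <= n)%N ->
  polyact p v = \sum_(i < n) p`_i *: iter i f v.
Proof.
move=> pn; rewrite /polyact -!(big_mkord xpredT (fun i => p`_i *: iter i f v)).
rewrite [RHS](big_cat_nat _ (n := size p)) //= [X in _ + X]big1_seq ?addr0 //.
by move=> i /andP[_]; rewrite mem_index_iota => /andP[/leq_sizeP-> //];
  rewrite scale0r.
Qed.

Lemma polyact_linear p : linear (polyact p).
Proof.
apply: linear_bigsum => i; apply: linear_scale; exact: iter_linear.
Qed.

Lemma polyactD p q v : polyact (p + q) v = polyact p v + polyact q v.
Proof.
rewrite !(@polyactEw (maxn (size p) (size q))) ?leq_maxl ?leq_maxr //.
  by rewrite -big_split; apply: eq_bigr => i _; rewrite coefD scalerDl.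
exact: size_polyD.
Qed.

Lemma polyactC c v : polyact c%:P v = c *: v.
Proof. by rewrite (@polyactEw 1) ?size_polyC ?leq_b1 // big_ord1 coefC. Qed.

Lemma polyactZ c p v : polyact (c *: p) v = c *: polyact p v.
Proof.
rewrite (@polyactEw (size p)) ?size_scale_leq // scaler_sumr.
by apply: eq_bigr => i _; rewrite coefZ scalerA.
Qed.

Lemma polyactMX p v : polyact (p * 'X) v = f (polyact p v).
Proof.
rewrite (@polyactEw (size p).+1); last first.
  by apply: leq_trans (size_polyMleq _ _) _; rewrite size_polyX addn2.
rewrite big_ord_recl coefMX scale0r add0r (linS fL); apply: eq_bigr => i _.
by rewrite coefMX /= (linZ fL).
Qed.

Lemma polyactM p q v : polyact (p * q) v = polyact p (polyact q v).
Proof.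
elim/poly_ind: p v => [|p c IH] v.
  by rewrite mul0r -polyC0 !polyactC !scale0r.
rewrite mulrDl !polyactD mul_polyC polyactZ polyactC; congr (_ + _).
by rewrite -mulrA [_ * q]mulrC mulrA !polyactMX IH.
Qed.

Lemma polyactXsubC c v : polyact ('X - c%:P) v = f v - c *: v.
Proof.
rewrite -polyCN polyactD -['X]mul1r polyactMX -polyC1 !polyactC.
by rewrite scale1r scaleNr.
Qed.

(** Each eigenvector is killed by a linear factor, so a finite sum of
    eigenvectors is killed by the product over the eigenvalues involved, listed
    without repetition. *)
Lemma diagonalizable_annihilator : diagonalizable f -> forall v,
  exists2 S, uniq S & polyact (\prod_(a <- S) ('X - a%:P)) v = 0.
Proof.
move=> fdiag v.
pose K := [set v | exists2 S, uniq S &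
  polyact (\prod_(a <- S) ('X - a%:P)) v = 0].
suff KV : lspan (\bigcup_a eigenspace f a) `<=` K by apply: KV; rewrite fdiag.
have mono (S T : seq k) w : uniq S -> uniq T -> {subset S <= T} ->
    polyact (\prod_(a <- S) ('X - a%:P)) w = 0 ->
    polyact (\prod_(a <- T) ('X - a%:P)) w = 0.
  move=> uS uT ST S0.
  have pT : perm_eq T ([seq a <- T | a \notin S] ++ S).
    apply: uniq_perm => // [|a].
      rewrite cat_uniq filter_uniq // uS andbT /=.
      by apply/hasPn => a aS; rewrite mem_filter aS.
    rewrite mem_cat mem_filter; case: (boolP (a \in S)) => [/ST|_] //=.
    by rewrite orbF.
  by rewrite (perm_big _ pT) big_cat /= polyactM S0 (lin0 (polyact_linear _)).
apply: smallest_sub => [|w [a _ wa]]; last first.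
  exists [:: a] => //; rewrite big_seq1 polyactXsubC.
  by rewrite (wa : f w = a *: w) subrr.
split=> [|a x y].
  by rewrite inE; exists [::] => //; rewrite (lin0 (polyact_linear _)).
rewrite !inE => -[S uS xS] [T uT yT]; exists (undup (S ++ T)).
  exact: undup_uniq.
set P := \prod_(b <- _) _.
have -> : polyact P x = 0 -> polyact P y = 0 -> polyact P (a *: x + y) = 0.
  by move=> x0 y0; rewrite (polyact_linear P) x0 y0 scaler0 addr0.
- by [].
- apply: mono xS => //; first exact: undup_uniq.
  by move=> b bS; rewrite mem_undup mem_cat bS.
- apply: mono yT => //; first exact: undup_uniq.
  by move=> b bS; rewrite mem_undup mem_cat bS orbT.
Qed.

(** Applying [f - b] to a relation removes the [b]-component and multiplies the
    others by nonzero scalars, whence induction on the list of eigenvalues. *)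
Lemma eigenspaces_independent (S : seq k) (w : k -> V) : uniq S ->
  (forall a, eigenspace f a (w a)) -> \sum_(a <- S) w a = 0 ->
  forall a, a \in S -> w a = 0.
Proof.
elim: S w => // b S IH w /= /andP[bS uS] wE; rewrite big_cons => w0.
have wS a : a \in S -> w a = 0.
  move=> aS; have ab : a - b != 0.
    by rewrite subr_eq0; apply: contraNneq bS => <-.
  apply: (scalerI ab); rewrite scaler0.
  apply: (IH (fun a => (a - b) *: w a)) => // [c|].
    by rewrite /eigenspace /= (linZ fL) (wE c) !scalerA mulrC.
  have := congr1 f w0; rewrite (lin0 fL) (linD fL) (linS fL) (wE b).
  move=> fw0; transitivity ((b *: w b + \sum_(c <- S) f (w c))
      - b *: (w b + \sum_(c <- S) w c)); last by rewrite fw0 w0 scaler0 subr0.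
  rewrite scalerDr opprD addrACA subrr add0r scaler_sumr -sumrB.
  by apply: eq_bigr => c _; rewrite (wE c) scalerBl.
move=> a; rewrite inE => /predU1P[->|/wS//].
by move: w0; rewrite big1_seq ?addr0 // => c /andP[_ /wS].
Qed.

(** The space is the direct sum of the eigenspaces, so a linear map on it may be
    prescribed on each of them separately.  Decompositions into eigenvectors are
    handled as lists of pairs of a scalar and a vector, repetitions allowed;
    independence of the eigenspaces makes the prescribed value depend only on the
    total of the list. *)
Lemma linear_by_eigenspaces (W : lmodType k) (phi : k -> V -> W) :
  diagonalizable f -> (forall a, linear (phi a)) ->
  exists2 rho : V -> W, linear rho &
    forall a v, eigenspace f a v -> rho v = phi a v.
Proof.
move=> fdiag phiL.
pose eigs (s : seq (k * V)) := forall e, e \in s -> eigenspace f e.1 e.2.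
pose total (s : seq (k * V)) := \sum_(e <- s) e.2.
pose value (s : seq (k * V)) := \sum_(e <- s) phi e.1 e.2.
have value0 s : eigs s -> total s = 0 -> value s = 0.
  move=> sE s0; pose T := undup [seq e.1 | e <- s].
  pose w a := \sum_(e <- s | e.1 == a) e.2.
  (* Gather the vectors that share an eigenvalue. *)
  have fibre (X : zmodType) (F : k * V -> X) :
      \sum_(e <- s) F e = \sum_(a <- T) \sum_(e <- s | e.1 == a) F e.
    rewrite (exchange_big_dep xpredT) //= big_seq [RHS]big_seq.
    apply: eq_bigr => e es; rewrite -big_filter.
    rewrite (eq_filter (a2 := pred1 e.1)); last by move=> a; rewrite /= eq_sym.
    by rewrite filter_pred1_uniq ?undup_uniq ?big_seq1 // mem_undup map_f.
  have wE a : eigenspace f a (w a).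
    rewrite /eigenspace /= /w (linS fL) scaler_sumr big_seq_cond.
    rewrite [RHS]big_seq_cond; apply: eq_bigr => e /andP[/sE pE /eqP<-].
    exact: pE.
  have w0 : \sum_(a <- T) w a = 0 by rewrite -fibre.
  rewrite /value fibre big1_seq // => a /andP[_ aT].
  have := eigenspaces_independent (undup_uniq _) wE w0 aT => wa0.
  rewrite -[RHS](lin0 (phiL a)) -wa0 /w (linS (phiL a)).
  by apply: eq_bigr => e /eqP->.
have ex_s v : exists s, eigs s /\ total s = v.
  pose K := [set v | exists s, eigs s /\ total s = v].
  suff KV : lspan (\bigcup_a eigenspace f a) `<=` K by apply: KV; rewrite fdiag.
  apply: smallest_sub => [|w [a _ wa]]; last first.
    exists [:: (a, w)]; split; last by rewrite /total big_seq1.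
    by move=> e; rewrite inE => /eqP->.
  split=> [|a x y]; rewrite !inE.
    by exists [::]; split=> //; rewrite /total big_nil.
  move=> [s [sE <-]] [t [tE <-]].
  exists ([seq (e.1, a *: e.2) | e <- s] ++ t); split.
    move=> e; rewrite mem_cat => /orP[/mapP[d /sE qE ->]|/tE //].
    by rewrite /eigenspace /= (linZ fL) qE !scalerA mulrC.
  by rewrite /total big_cat big_map scaler_sumr.
have [L LP] := choice ex_s.
have rhoE s : eigs s -> value s = value (L (total s)).
  move=> sE; have [LE Lt] := LP (total s).
  pose t := [seq (e.1, - e.2) | e <- L (total s)].
  have tE : eigs (s ++ t).
    move=> e; rewrite mem_cat => /orP[/sE //|/mapP[d /LE qE ->]].
    by rewrite /eigenspace /= -scaleN1r (linZ fL) qE !scalerA mulrC.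
  have phiN : \sum_(e <- L (total s)) phi e.1 (- e.2) = - value (L (total s)).
    rewrite /value -sumrN; apply: eq_bigr => e _.
    by rewrite -[- e.2]scaleN1r (linZ (phiL _)) scaleN1r.
  have := value0 _ tE; rewrite /total /value !big_cat !big_map /= sumrN phiN.
  rewrite -!/(total _) -!/(value _) Lt subrr => /(_ erefl)/eqP.
  by rewrite subr_eq0 => /eqP.
exists (fun v => value (L v)) => [a x y|a v vE].
  have [xE xt] := LP x; have [yE yt] := LP y.
  pose s := [seq (e.1, a *: e.2) | e <- L x] ++ L y.
  have st : total s = a *: x + y.
    by rewrite /s /total big_cat big_map -scaler_sumr -!/(total _) xt yt.
  rewrite -st -rhoE; last first.
    move=> e; rewrite mem_cat => /orP[/mapP[d /xE qE ->]|/yE //].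
    by rewrite /eigenspace /= (linZ fL) qE !scalerA mulrC.
  rewrite /s /value big_cat big_map /= scaler_sumr; congr (_ + _).
  by apply: eq_bigr => e _; rewrite (linZ (phiL _)).
have sE : eigs [:: (a, v)] by move=> e; rewrite inE => /eqP->.
by have := rhoE _ sE; rewrite /total /value !big_seq1 /= => <-.
Qed.

End PolynomialAction.

Section OrbitRoots.
Variables (k : fieldType) (G : groupType) (f : grp_aut G).

Local Notation kG := {malg k[G]}.
Local Notation F := (@galg_map k G f).

Lemma iter_galg_map i (x : G) : iter i F << x >> = << iter i f x >>.
Proof. by elim: i => [|i IH] //=; rewrite IH galg_mapU. Qed.

Variables (x : G) (r : nat).
Hypothesis xr : orbit_cycle f x r.

Lemma mcoeff_orbit_sum (c : nat -> k) j : (j < r)%N ->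
  (\sum_(i < r) c i *: (<< iter i f x >> : kG))@_(iter j f x) = c j.
Proof.
have [_ _ inj] := xr => jr; rewrite raddf_sum (bigD1 (Ordinal jr)) //=.
rewrite mcoeffZ mcoeffUU mulr1 big1 ?addr0 // => i ij.
rewrite mcoeffZ mcoeffU; case: eqP => [/inj E|]; last by rewrite mulr0.
by case/eqP: ij; apply: val_inj; apply: E.
Qed.

(** The translates of [x] are linearly independent, so [X^r - 1] generates the
    annihilator of [x]. *)
Lemma orbit_annihilator (p : {poly k}) :
  polyact F p (<< x >> : kG) = 0 -> 'X^r - 1 %| p.
Proof.
have FL : linear F by exact: galg_map_linear.
have [r0 fr inj] := xr; move=> px.
have m_x : polyact F ('X^r - 1) (<< x >> : kG) = 0.
  rewrite -polyC1 -polyCN polyactD // polyactC scaleN1r -['X^r]mul1r.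
  have -> n : polyact F (1 * 'X^n) (<< x >> : kG) = << iter n f x >>.
    elim: n => [|n IH]; first by rewrite mulr1 -polyC1 polyactC // scale1r.
    by rewrite exprSr mulrA polyactMX // IH galg_mapU.
  by rewrite fr subrr.
rewrite /dvdp; set s := _ %% _.
have sz_s : (size s <= r)%N.
  by rewrite -ltnS -(size_Xn_sub_1 k r0) ltn_modp monic_neq0 ?monic_Xn_sub_1.
have : polyact F s (<< x >> : kG) = 0.
  move: px; rewrite [p in polyact _ p](divp_eq p ('X^r - 1)) polyactD //.
  by rewrite polyactM // m_x (lin0 (polyact_linear FL _)) add0r.
rewrite (polyactEw _ _ sz_s) => s0; apply/eqP/polyP => j; rewrite coef0.
have [rj|jr] := leqP r j; first by rewrite nth_default // (leq_trans sz_s).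
have := congr1 (mcoeff (iter j f x)) s0; rewrite mcoeff0 => E.
rewrite -[RHS]E -[LHS](mcoeff_orbit_sum (fun i => s`_i) jr); congr (mcoeff _ _).
by apply: eq_bigr => i _; rewrite iter_galg_map.
Qed.

(** A product of distinct linear factors kills [x], hence is a multiple of
    [X^r - 1], which therefore has [r] distinct roots in [k]; these form a cyclic
    group. *)
Lemma diagonalizable_prim_root : diagonalizable F ->
  exists z : k, r.-primitive_root z.
Proof.
have FL : linear F by exact: galg_map_linear.
have [r0 _ _] := xr => Fdiag.
have [S uS /orbit_annihilator/dvdp_prod_XsubC[m mP]] :=
  diagonalizable_annihilator FL Fdiag (<< x >> : kG).
have /hasP[z _ zP] : has r.-primitive_root (mask m S); last by exists z.
apply: cyclic.has_prim_root => //; last 1 first.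
- by rewrite -ltnS -(size_prod_XsubC _ id) -(eqp_size mP) size_Xn_sub_1.
- apply/allP => a am; rewrite /root_of_unity (eqp_root mP).
  by rewrite root_prod_XsubC.
exact: mask_uniq.
Qed.

(** The translates of [x] weighted by the powers of [a^-1] add up to an
    eigenvector because [a ^ r = 1] makes the weights periodic; it is not zero
    because the translates are linearly independent. *)
Lemma unity_root_eigenvalue (a : k) : a ^+ r = 1 ->
  @eigenvalue k (galg k G) F a.
Proof.
have [r0 fr _] := xr => ar.
have a0 : a != 0.
  apply: contra_eq_neq ar => ->.
  by rewrite expr0n gtn_eqF // eq_sym oner_eq0.
exists (\sum_(i < r) a ^- i *: (<< iter i f x >> : kG)); last first.
  apply/eqP => /(congr1 (mcoeff x)).
  rewrite (mcoeff_orbit_sum (fun i => a ^- i) (j := 0)) // mcoeff0 expr0 invr1.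
  by move/eqP; rewrite oner_eq0.
rewrite /eigenspace /= (linS (@galg_map_linear _ _ f)) scaler_sumr.
case: r r0 fr ar => // n _ fr ar; rewrite big_ord_recr big_ord_recl /= addrC.
congr (_ + _).
  have -> : a ^- n = a.
    apply: (mulfI (expf_neq0 n a0)).
    by rewrite mulfV ?expf_neq0 // -exprSr ar.
  rewrite (linZ (@galg_map_linear _ _ f)) galg_mapU -iterS fr.
  by rewrite expr0 invr1 scale1r.
apply: eq_bigr => i _; rewrite (linZ (@galg_map_linear _ _ f)) galg_mapU scalerA.
by rewrite /bump /= add1n add0n exprS invfM mulrA mulfV // mul1r.
Qed.

End OrbitRoots.

(** * Fourier analysis on a cyclic orbit *)

Section PrimitiveRoots.
Variables (k : fieldType) (r : nat) (z : k).
Hypothesis zr : r.-primitive_root z.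

Lemma prim_root_neq0 : z != 0.
Proof.
have := prim_expr_order zr; apply: contra_eq_neq => ->.
by rewrite expr0n gtn_eqF ?(prim_order_gt0 zr) // eq_sym oner_eq0.
Qed.

Lemma prim_root_inj a b : (a < r)%N -> (b < r)%N ->
  (z ^+ a == z ^+ b) = (a == b).
Proof. by move=> ar br; rewrite (eq_prim_root_expr zr) !modn_small. Qed.

Lemma root_ratioX a b : (z ^+ a / z ^+ b) ^+ r = 1.
Proof.
rewrite expr_div_n exprAC (prim_expr_order zr) expr1n.
by rewrite exprAC (prim_expr_order zr) expr1n divr1.
Qed.

End PrimitiveRoots.

Lemma sum_root_powers (k : fieldType) r (w : k) : w ^+ r = 1 ->
  \sum_(j < r) w ^+ j = if w == 1 then r%:R else 0.
Proof.
move=> wr; case: eqP => [->|/eqP w1].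
  by under eq_bigr do rewrite expr1n; rewrite sumr_const card_ord.
apply: (@mulfI _ (w - 1)); first by rewrite subr_eq0.
by rewrite -subrX1 wr subrr mulr0.
Qed.

Lemma root_sum_orthogonal (k : fieldType) (V : lmodType k) r (z : k)
    (e : 'I_r -> V) (b : 'I_r) : r.-primitive_root z ->
  r%:R^-1 *: \sum_(j < r) \sum_(p < r) (z ^+ p / z ^+ b) ^+ j *: e p = e b.
Proof.
move=> zr; have rn0 := prim_root_natf_neq0 zr.
have zX0 n : z ^+ n != 0 by rewrite expf_neq0 ?(prim_root_neq0 zr).
have sumE (p : 'I_r) :
    \sum_(j < r) (z ^+ p / z ^+ b) ^+ j = if p == b then r%:R else 0.
  rewrite sum_root_powers ?root_ratioX // -(inj_eq (mulIf (zX0 b))) mulfVK //.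
  by rewrite mul1r (prim_root_inj zr).
rewrite exchange_big /= scaler_sumr (bigD1 b) //= [X in _ + X]big1 ?addr0.
  by rewrite -scaler_suml sumE eqxx scalerA mulVf // scale1r.
by move=> p pb; rewrite -scaler_suml sumE (negPf pb) scale0r scaler0.
Qed.

Section Spectrum.
Variables (k : fieldType) (V : lmodType k) (f : V -> V).
Hypothesis fL : linear f.
Variables (r : nat) (v : V).
Hypothesis fr : iter r f v = v.

(** The component of [v] in the eigenspace of [f] for [w^-1], provided that
    [f ^ r] fixes [v] and [w ^ r = 1]. *)
Definition spectral (w : k) : V :=
  r%:R^-1 *: \sum_(j < r) w ^+ j *: iter j f v.

Lemma spectral_eigen w : w ^+ r = 1 -> eigenspace f w^-1 (spectral w).
Proof.
rewrite /eigenspace /spectral /=; case: r fr => [|n] fn wr.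
  by rewrite !big_ord0 !scaler0 (lin0 fL).
have w0 : w != 0.
  by apply: contra_eq_neq wr => ->; rewrite expr0n eq_sym oner_eq0.
rewrite (linZ fL) scalerA mulrC -scalerA; congr (_ *: _).
rewrite (linS fL) scaler_sumr big_ord_recr [RHS]big_ord_recl /= addrC.
congr (_ + _).
  rewrite (linZ fL) -iterS fn expr0 scale1r; congr (_ *: _).
  by apply: (mulIf w0); rewrite mulVf // -exprSr.
apply: eq_bigr => j _; rewrite (linZ fL) scalerA /bump /= add1n exprS mulrA.
by rewrite mulVf // mul1r.
Qed.

(** Fourier inversion on the cyclic group of order [r].  The parameter [a] only
    relabels the frequencies: the comatrix entry [(a, b)] of an orbit is the
    coefficient at the ratio [z ^ a / z ^ b]. *)
Lemma spectral_inversion (z : k) i a : r.-primitive_root z -> (i < r)%N ->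
  iter i f v = \sum_(b < r) (z ^+ b / z ^+ a) ^+ i *: spectral (z ^+ a / z ^+ b).
Proof.
move=> zr ir; have zX0 n : z ^+ n != 0 by rewrite expf_neq0 ?(prim_root_neq0 zr).
have r0 := prim_root_natf_neq0 zr.
have zX n : (z ^+ n) ^+ r = 1 by rewrite exprAC (prim_expr_order zr) expr1n.
transitivity (\sum_(j < r) (r%:R^-1 *
    \sum_(b < r) (z ^+ b / z ^+ a) ^+ i * (z ^+ a / z ^+ b) ^+ j) *: iter j f v).
  have sumE (j : 'I_r) :
      \sum_(b < r) (z ^+ b / z ^+ a) ^+ i * (z ^+ a / z ^+ b) ^+ j =
      if j == i :> nat then r%:R else 0.
    transitivity ((z ^+ a) ^+ j / (z ^+ a) ^+ i *
        \sum_(b < r) (z ^+ i / z ^+ j) ^+ b).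
      rewrite mulr_sumr; apply: eq_bigr => b _.
      rewrite !expr_div_n ![(z ^+ b) ^+ _]exprAC -!mulrA.
      rewrite [RHS]mulrCA mulrC !mulrA mulrAC.
      by congr (_ * _); rewrite mulrC mulrA.
    rewrite sum_root_powers ?expr_div_n ?zX ?divr1 // -(inj_eq (mulIf (zX0 j))).
    rewrite mul1r mulfVK // (eq_prim_root_expr zr) !modn_small // eq_sym.
    by case: eqP => [->|_]; rewrite ?mulr0 // mulfV ?mul1r // expf_neq0.
  under eq_bigr => j _ do rewrite sumE.
  rewrite (bigD1 (Ordinal ir)) //= eqxx mulVf // scale1r.
  by rewrite big1 ?addr0 // => j ji; rewrite ifN ?mulr0 ?scale0r.
under eq_bigr => j _.
  rewrite mulr_sumr scaler_suml; over.
rewrite exchange_big; apply: eq_bigr => b _ /=.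
rewrite /spectral !scaler_sumr; apply: eq_bigr => j _.
by rewrite !scalerA mulrCA mulrA.
Qed.

End Spectrum.

(** For [w ^ r = 1], with [u] of order [r] invertible in [k], these are orthogonal
    idempotents of the group algebra of the cyclic group generated by [u].  For
    [u] the image of a primitive [r]-th root of unity they are the matrix
    coefficients of the comodule spanned by an orbit of length [r]. *)
HB.lock Definition cyclic_coef (k : fieldType) (G : groupType) (u : G) (r : nat)
    (w : k) : galg k G :=
  r%:R^-1 *: \sum_(j < r) w ^+ j *: << (u ^+ j)%g >>.

Section CyclicCoefficients.
Variables (k : fieldType) (G : groupType) (u : G) (r : nat).
Hypothesis ur : (u ^+ r = 1)%g.

Local Notation kG := (galg k G).

Local Notation coef := (@cyclic_coef k G u r).

Lemma iter_galg_mul j (h : G) :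
  iter j (galg_mul (<< u >> : kG)) << h >> = << (u ^+ j * h)%g >>.
Proof.
elim: j => [|j IH]; first by rewrite mul1g.
by rewrite iterS IH galg_mulU mulgA -expgS.
Qed.

Lemma cyclic_coef_def w :
  coef w = r%:R^-1 *: \sum_(j < r) w ^+ j *: << (u ^+ j)%g >>.
Proof. by rewrite cyclic_coef.unlock. Qed.

Lemma cyclic_coefE w :
  coef w = spectral (galg_mul (<< u >> : kG)) r << 1%g >> w.
Proof.
rewrite cyclic_coef_def; congr (_ *: _); apply: eq_bigr => j _; congr (_ *: _).
by rewrite iter_galg_mul mulg1.
Qed.

Let u_fix : iter r (galg_mul (<< u >> : kG)) << 1%g >> = << 1%g >>.
Proof. by rewrite iter_galg_mul ur mulg1. Qed.

Lemma cyclic_coef_inversion (z : k) i a : r.-primitive_root z -> (i < r)%N ->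
  (<< (u ^+ i)%g >> : kG) =
    \sum_(b < r) (z ^+ b / z ^+ a) ^+ i *: coef (z ^+ a / z ^+ b).
Proof.
move=> zr ir; rewrite -[in LHS](mulg1 (u ^+ i)%g) -iter_galg_mul.
rewrite (spectral_inversion (galg_mul (<< u >> : kG)) _ a zr ir).
by apply: eq_bigr => b _; rewrite cyclic_coefE.
Qed.

Lemma galg_mul_cyclic_coef i w : w ^+ r = 1 ->
  galg_mul (<< (u ^+ i)%g >> : kG) (coef w) = w ^- i *: coef w.
Proof.
move=> wr; elim: i => [|i IH].
  have [_ _ one_mul _] := galg_is_algebra k G.
  by rewrite expr0 invr1 scale1r; exact: one_mul.
have [_ mulA _ _] := galg_is_algebra k G.
rewrite expgSr -galg_mulU -[LHS]mulA /=.
have -> : galg_mul << u >> (coef w) = w^-1 *: coef w.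
  by rewrite cyclic_coefE; exact: (spectral_eigen (galg_mull _) u_fix wr).
by rewrite (linZ (galg_mull _)) IH scalerA exprS invfM.
Qed.

Lemma cyclic_coef_mul w w' : r%:R != 0 :> k -> w ^+ r = 1 -> w' ^+ r = 1 ->
  galg_mul (coef w) (coef w') =
    if w == w' then coef w' else 0.
Proof.
move=> r0 wr wr'; have w'0 : w' != 0.
  apply: contraNneq r0 => w'0; move: wr'; rewrite w'0 expr0n.
  by case: r => // n /eqP; rewrite eq_sym oner_eq0.
have mulZ := linZ (galg_mulr (coef w')).
rewrite (cyclic_coef_def w) mulZ (linS (galg_mulr _)).
transitivity (r%:R^-1 *: ((\sum_(j < r) (w / w') ^+ j) *: coef w')).
  congr (_ *: _); rewrite scaler_suml; apply: eq_bigr => j _.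
  rewrite mulZ (galg_mul_cyclic_coef j wr') scalerA.
  by rewrite expr_div_n.
rewrite sum_root_powers ?expr_div_n ?wr ?wr' ?divr1 //.
rewrite -(inj_eq (mulIf w'0)) mulfVK // mul1r scalerA.
by case: eqP; rewrite ?mulVf ?scale1r // mulr0 scale0r.
Qed.

Lemma cyclic_coef_counit w : r%:R != 0 :> k -> w ^+ r = 1 ->
  counit (coef w) = (w == 1)%:R.
Proof.
move=> r0 wr; rewrite cyclic_coef_def /= (linZ (lext_is_linear _)).
rewrite (linS (lext_is_linear _)).
under eq_bigr => j _ do rewrite (linZ (lext_is_linear _)) lextU.
rewrite (eq_bigr (fun j : 'I_r => w ^+ j)); last by move=> j _; exact: mulr1.
rewrite sum_root_powers //; case: eqP => _; last exact: mulr0.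
exact: mulVf.
Qed.

(** Expanding one of the two tensor factors [u ^ j] by Fourier inversion turns
    the diagonal coproduct of the powers of [u] into the coproduct of a comatrix
    coalgebra. *)
Lemma cyclic_coef_comul (z : k) a b : r.-primitive_root z ->
  comul (coef (z ^+ a / z ^+ b)) =
    \sum_(c < r) coef (z ^+ a / z ^+ c) ⊗ coef (z ^+ c / z ^+ b).
Proof.
move=> zr; have r0 := prim_root_natf_neq0 zr.
have zX0 n : z ^+ n != 0 by rewrite expf_neq0 ?(prim_root_neq0 zr).
rewrite (cyclic_coef_def (z ^+ a / z ^+ b)) /= (linZ (lext_is_linear _)).
rewrite (linS (lext_is_linear _)).
rewrite scaler_sumr.
under [RHS]eq_bigr => c _.
  rewrite (cyclic_coef_def (z ^+ c / z ^+ b)) tens_scaler tens_sumr.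
  rewrite scaler_sumr; over.
rewrite exchange_big; apply: eq_bigr => i _ /=.
rewrite (linZ (lext_is_linear _)) lextU -scaler_sumr; congr (_ *: _).
rewrite {1}(cyclic_coef_inversion a zr (ltn_ord i)) tens_suml scaler_sumr.
apply: eq_bigr => c _.
have <- : (z ^+ a / z ^+ b) ^+ i * (z ^+ c / z ^+ a) ^+ i =
          (z ^+ c / z ^+ b) ^+ i.
  by rewrite -exprMn mulrC mulrA mulfVK.
rewrite (tens_scalel ((z ^+ c / z ^+ a) ^+ i)) [LHS]scalerA.
exact/esym/(tens_scaler ((z ^+ a / z ^+ b) ^+ i * (z ^+ c / z ^+ a) ^+ i)).
Qed.

End CyclicCoefficients.

(** * Automorphisms acting on the group algebra *)

Section AutomorphismTheory.
Variables (k : fieldType) (G : groupType) (f : grp_aut G).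

Local Notation kG := (galg k G).
Local Notation F := (@galg_map k G f).
Implicit Types x y : kG.

Lemma galg_mapM x y : F (galg_mul x y) = galg_mul (F x) (F y).
Proof.
move: x; apply: malg_ext => [||g]; [lin|lin|].
move: y; apply: malg_ext => [||h]; [lin|lin|].
by rewrite !galg_mapU !galg_mulU galg_mapU aut_funM.
Qed.

Lemma aut_fun1 : f 1%g = 1%g.
Proof. by apply: (@mulgI _ (f 1%g)); rewrite -aut_funM !mulg1. Qed.

Lemma aut_funV g : f (g^-1)%g = ((f g)^-1)%g.
Proof. by apply: (@mulgI _ (f g)); rewrite -aut_funM !mulgV aut_fun1. Qed.

Lemma galg_map_counit x : counit (F x : kG) = counit x.
Proof.
move: x; apply: (malg_ext (V := k^o)) => /= [||g]; [lin|lin|].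
by rewrite galg_mapU !lextU.
Qed.

Lemma galg_map_antipode x : F (galg_antipode x) = galg_antipode (F x).
Proof.
move: x; apply: malg_ext => /= [||g]; [lin|lin|].
by rewrite galg_antipodeU !galg_mapU galg_antipodeU aut_funV.
Qed.

Lemma galg_map_inj : injective F.
Proof.
pose F' := @galg_map k G (aut_inv f).
have F'K x : F' (F x) = x.
  move: x; apply: malg_ext => /= [||g]; [lin|lin|].
  by rewrite galg_mapU /F' galg_mapU /= aut_funK.
exact: can_inj F'K.
Qed.

End AutomorphismTheory.

Section ActionTheory.
Variables (k : fieldType) (G GG : groupType).
Variable pi : {multiplicative G -> grp_aut GG}.

Local Notation H := (galg k G).
Local Notation B := (galg k GG).
Local Notation act := (@galg_act k G GG pi).

Lemma galg_actl (h : H) : linear (act h).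
Proof. by rewrite /galg_act; lin. Qed.

Lemma galg_actr (b : B) : linear (fun h => act h b).
Proof. by rewrite /galg_act; lin. Qed.

Lemma galg_actU g (b : B) : act << g >> b = galg_map (pi g) b.
Proof. by rewrite /galg_act lextU. Qed.

Lemma mult_hom1 : pi 1%g = 1%g.
Proof. by apply: (@mulgI _ (pi 1%g)); rewrite -gmulfM !mulg1. Qed.

Lemma galg_map1 (b : B) : galg_map (1%g : grp_aut GG) b = b.
Proof. by move: b; apply: malg_ext => [||x]; [lin|lin|rewrite galg_mapU]. Qed.

Lemma galg_map_mul (s t : grp_aut GG) (b : B) :
  galg_map (s * t)%g b = galg_map s (galg_map t b).
Proof. by move: b; apply: malg_ext => [||x]; [lin|lin|rewrite !galg_mapU]. Qed.

Lemma galg_act1 (b : B) : act << 1%g >> b = b.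
Proof. by rewrite galg_actU mult_hom1 galg_map1. Qed.

Lemma galg_actM (h h' : H) (b : B) : act (galg_mul h h') b = act h (act h' b).
Proof.
have actl := galg_actl; have actr := galg_actr.
move: h; apply: malg_ext => [||g]; [lin|lin|].
move: h'; apply: malg_ext => [||g']; [lin|lin|].
by rewrite galg_mulU !galg_actU gmulfM galg_map_mul.
Qed.

End ActionTheory.

Ltac lin_base ::=
  lazymatch goal with
  | |- GRing.linear_for _ (galg_mul _) => refine (galg_mull _)
  | |- GRing.linear_for _ (fun x => galg_mul _ x) => refine (galg_mull _)
  | |- GRing.linear_for _ (fun x => galg_mul x _) => refine (galg_mulr _)
  | |- GRing.linear_for _ (@galg_antipode _ _) =>
      refine (@galg_antipode_linear _ _)
  | |- GRing.linear_for _ (fun x => galg_antipode x) =>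
      refine (@galg_antipode_linear _ _)
  | |- GRing.linear_for _ (galg_map _) => refine (galg_map_linear _)
  | |- GRing.linear_for _ (fun x => galg_map _ x) => refine (galg_map_linear _)
  | |- GRing.linear_for _ (galg_act _ _) => refine (galg_actl _ _)
  | |- GRing.linear_for _ (fun x => galg_act _ _ x) => refine (galg_actl _ _)
  | |- GRing.linear_for _ (fun x => galg_act _ x _) => refine (galg_actr _ _)
  end.

(** * Comatrix families *)

Section ComatrixFamilies.
Variables (k : fieldType) (C : coalgData k).

(** The image of the standard basis under a coalgebra map from a comatrix
    coalgebra. *)
Definition comatrix_family r (e : 'I_r -> 'I_r -> C) : Prop :=
  (forall a b, comul (e a b) = \sum_p e a p ⊗ e p b) /\
  (forall a b, counit (e a b) = (a == b)%:R).

Definition comatrix_entries : set C :=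
  [set c | exists r (e : 'I_r -> 'I_r -> C) a b, comatrix_family e /\ c = e a b].

Hypothesis comul_linear : linear (@comul k C).
Hypothesis counit_linear : linear (@counit k C : C -> k^o).

(** The coalgebra axioms hold on the entries of a comatrix family, where they say
    that matrix multiplication is associative and unital. *)
Lemma comatrix_coalgebra : lspan comatrix_entries = setT -> is_coalgebra C.
Proof.
move=> span.
have ext (X : lmodType k) (f g : C -> X) : linear f -> linear g ->
    (forall r (e : 'I_r -> 'I_r -> C) a b, comatrix_family e ->
      f (e a b) = g (e a b)) -> forall c, f c = g c.
  move=> fL gL fg c; apply: (lspan_ext fL gL (S := comatrix_entries)).
    by move=> _ [r [e [a [b [eP ->]]]]]; exact: fg.
  by rewrite span.
split=> // [c|c|c].
- move: c; apply: ext => [||r e a b [eD eE]]; [lin|lin|].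
  rewrite eD !tsum_sum_tens; try by lin.
  transitivity (\sum_p \sum_q e a p ⊗ (e p q ⊗ e q b)).
    rewrite exchange_big; apply: eq_bigr => p _.
    by rewrite eD tsum_sum_tens //; lin.
  by apply: eq_bigr => p _; rewrite eD tsum_sum_tens //; lin.
- move: c; apply: ext => [||r e a b [eD eE]]; [lin|lin|].
  rewrite eD tsum_sum_tens; last by lin.
  rewrite (bigD1 a) //= eE eqxx scale1r big1 ?addr0 // => p pa.
  by rewrite eE eq_sym (negPf pa) scale0r.
- move: c; apply: ext => [||r e a b [eD eE]]; [lin|lin|].
  rewrite eD tsum_sum_tens; last by lin.
  rewrite (bigD1 b) //= eE eqxx scale1r big1 ?addr0 // => p pb.
  by rewrite eE (negPf pb) scale0r.
Qed.

Lemma subcoalgebra_tsum (D : set C) (f : C -> C -> C) : is_subcoalgebra D ->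
  bilinear f -> (forall x y, D x -> D y -> D (f x y)) ->
  forall c, D c -> D (tsum f (comul c)).
Proof.
move=> [[D0 Dlin] Dcomul] fB fD c /Dcomul; set t := comul c.
pose K := [set t | D (tsum f t)].
suff : lspan [set x ⊗ y | x in D & y in D] `<=` K by apply.
apply: smallest_sub => [|_ [x xD [y yD <-]]]; last first.
  by rewrite /K /= tsum_tens //; exact: fD.
split=> [|a u v]; rewrite !inE /K /=.
  by rewrite (lin0 (tsum_linear fB)); rewrite inE in D0.
rewrite (tsum_linear fB) => uD vD.
by have := Dlin a (tsum f u) (tsum f v); rewrite !inE; apply.
Qed.

(** Applying dual functionals to the outer tensor factors of the iterated
    coproduct of an element with nonzero coordinate at [(a, b)] yields a nonzero
    multiple of any prescribed entry [e p q], so a nonzero subcoalgebra contains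
    the whole family. *)
Lemma comatrix_family_simple r (e : 'I_r -> 'I_r -> C)
    (phi : 'I_r -> 'I_r -> C -> k^o) : (0 < r)%N -> comatrix_family e ->
  (forall a b, linear (phi a b)) ->
  (forall a b p q, phi a b (e p q) = ((a == p) && (b == q))%:R) ->
  is_simple_subcoalgebra (lspan [set e p.1 p.2 | p in [set: 'I_r * 'I_r]]).
Proof.
move=> r0 [eD _] phiL phiE; set X := [set _ | _ in _]; set D := lspan X.
have DX : X `<=` D by exact: sub_gen_smallest.
have Dlin : submod_closed (mem D) := in_lspan_submod X.
have De a b : D (e a b) by apply: DX; exists (a, b).
have Dexp c : D c -> c = \sum_a \sum_b (phi a b c : k) *: e a b.
  apply: (lspan_ext (f := fun c => c)
    (g := fun c => \sum_a \sum_b (phi a b c : k) *: e a b)); [lin|lin|].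
  move=> _ [[a b] _ <-] /=; rewrite (bigD1 a) //= (bigD1 b) //= phiE !eqxx.
  rewrite scale1r big1 ?addr0 => [|q qb]; last first.
    by rewrite phiE (negPf qb) andbF scale0r.
  rewrite big1 ?addr0 // => p pa; rewrite big1 // => q _.
  by rewrite phiE (negPf pa) scale0r.
have comulL := comul_linear.
split.
- split=> // c.
  pose K := [set c | lspan [set x ⊗ y | x in D & y in D] (comul c)].
  suff : D `<=` K by apply.
  apply: smallest_sub => [|_ [[a b] _ <-]]; last first.
    rewrite /K /= eD.
    suff : \sum_p e a p ⊗ e p b \in in_lspan [set x ⊗ y | x in D & y in D].
      by rewrite inE.
    apply: rpred_sum => p _; rewrite inE; apply: sub_gen_smallest.
    by exists (e a p) => //; exists (e p b).
  have [T0 Tl] := in_lspan_submod [set x ⊗ y | x in D & y in D].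
  split=> [|a x y]; rewrite !inE /K /=.
    by rewrite (lin0 comulL); rewrite inE in T0.
  move=> xK yK; rewrite comulL; have := Tl a (comul x) (comul y).
  by rewrite !inE; apply.
- pose o : 'I_r := Ordinal r0.
  move=> D0; have := phiE o o o o; rewrite !eqxx /=.
  have -> : e o o = 0 by have := De o o; rewrite D0.
  by rewrite (lin0 (phiL o o)) => /eqP; rewrite eq_sym oner_eq0.
move=> E Esub ED; have [[E0 El] _] := Esub.
have [->|] := pselect (E = [set 0]); first by left.
move=> En0; right; apply/seteqP; split=> //.
have [c cE c0] : exists2 c, E c & c <> 0.
  apply: contrapT => noc; apply: En0; apply/seteqP; split=> [c cE|_ ->].
    by apply: contrapT => c0; apply: noc; exists c.
  by rewrite inE in E0.
have [a [b ab0]] : exists a b, phi a b c != 0.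
  apply: contrapT => noab; apply: c0; rewrite (Dexp c (ED _ cE)).
  rewrite big1 // => a _; rewrite big1 // => b _.
  suff -> : phi a b c = 0 by rewrite scale0r.
  by apply/eqP; apply: contrapT => /negP ab0; apply: noab; exists a, b.
have Ee p q : E (e p q).
  have EZ s x : E x -> E (s *: x).
    move=> xE; have := El s x 0; rewrite !inE addr0; apply=> //.
    by rewrite inE in E0.
  have phiap := phiL a p; have phiqb := phiL q b.
  have cE1 : E (\tsum_(c1, c2 <- comul c) ((phi a p c1 : k) *: c2)).
    by apply: subcoalgebra_tsum => //; [lin|move=> x y _; exact: EZ].
  have : E (\tsum_(c1, c2 <- comul (\tsum_(c1, c2 <- comul c)
      ((phi a p c1 : k) *: c2))) ((phi q b c2 : k) *: c1)).
    by apply: subcoalgebra_tsum => //; [lin|move=> x y xE _; exact: EZ].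
  suff -> : \tsum_(c1, c2 <- comul (\tsum_(c1, c2 <- comul c)
      ((phi a p c1 : k) *: c2))) ((phi q b c2 : k) *: c1) =
      (phi a b c : k) *: e p q.
    by move=> /(EZ (phi a b c : k)^-1); rewrite scalerA mulVf // scale1r.
  move: (ED _ cE).
  apply: (lspan_ext (f := fun c =>
      \tsum_(c1, c2 <- comul (\tsum_(c1, c2 <- comul c)
        ((phi a p c1 : k) *: c2))) ((phi q b c2 : k) *: c1))
    (g := fun c => (phi a b c : k) *: e p q)); [lin|lin|].
  move=> _ [[i j] _ <-] /=.
  rewrite eD tsum_sum_tens; last by lin.
  have -> : \sum_l (phi a p (e i l) : k) *: e l j =
      ((a == i)%:R : k) *: e p j.
    rewrite (bigD1 p) //= phiE eqxx andbT big1 ?addr0 // => l lp.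
    by rewrite phiE eq_sym [p == l]eq_sym (negPf lp) andbF scale0r.
  rewrite (linZ comulL) eD (linZ (tsum_linear _)); last by lin.
  rewrite tsum_sum_tens; last by lin.
  have -> : \sum_l (phi q b (e l j) : k) *: e p l = ((b == j)%:R : k) *: e p q.
    rewrite (bigD1 q) //= phiE eqxx big1 ?addr0 // => l lq.
    by rewrite phiE [q == l]eq_sym (negPf lq) scale0r.
  by rewrite scalerA -natrM mulnb phiE.
apply: smallest_sub; first by split.
by move=> _ [[p q] _ <-]; exact: Ee.
Qed.

End ComatrixFamilies.

(** * Direct sums of coalgebras *)

Section DirectSumTheory.
Variables (k : fieldType) (I : choiceType) (V : I -> lmodType k).
Implicit Types (x y : dsum V) (i j : I).

Lemma dsum_valP a x y i :
  dsum_val (a *: x + y) i = a *: dsum_val x i + dsum_val y i.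
Proof. by []. Qed.

Lemma dsum_val_linear i : linear (fun x => dsum_val x i).
Proof. by []. Qed.

Lemma dsum_ext x y : (forall i, dsum_val x i = dsum_val y i) -> x = y.
Proof.
by move=> xy; apply: val_inj; apply: functional_extensionality_dep.
Qed.

Lemma dsum_in_same i (v : V i) : dsum_val (dsum_in v) i = v.
Proof. exact: dfwith_in. Qed.

Lemma dsum_in_other i j (v : V i) : i != j -> dsum_val (dsum_in v) j = 0.
Proof. exact: (dfwith_out (fun j => 0 : V j)). Qed.

Lemma dsum_in_linear i : linear (@dsum_in k I V i).
Proof.
move=> a v w; apply: dsum_ext => j; rewrite dsum_valP.
have [<-|ij] := eqVneq i j; first by rewrite !dsum_in_same.
by rewrite !dsum_in_other // scaler0 addr0.
Qed.

Lemma dsum_finite x : finite_set (dsupp (dsum_val x)).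
Proof. by have := valP x; rewrite unfold_in => /asboolP. Qed.

Lemma dsum_expand x :
  x = \sum_(i <- fset_set (dsupp (dsum_val x))) dsum_in (dsum_val x i).
Proof.
have fin := dsum_finite x; apply: dsum_ext => j.
rewrite (linS (dsum_val_linear j)).
have [jx|jx] := boolP (j \in fset_set (dsupp (dsum_val x))).
  rewrite (bigD1_seq j) // dsum_in_same big1 => [|i ij].
    by rewrite [RHS]addr0.
  by rewrite dsum_in_other.
rewrite big1_seq => [|i /andP[_ ix]]; last first.
  by rewrite dsum_in_other //; apply: contraNneq jx => <-.
move: jx; rewrite in_fset_set // notin_setE /dsupp /=.
by move=> /negP/negPn/eqP.
Qed.

Lemma dsum_linear_ext (W : lmodType k) (f g : dsum V -> W) :
  linear f -> linear g -> (forall i v, f (dsum_in (i := i) v) = g (dsum_in v)) ->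
  forall x, f x = g x.
Proof.
move=> fL gL fg x; rewrite [x]dsum_expand (linS fL) (linS gL).
by apply: eq_bigr => i _; exact: fg.
Qed.

(** The universal property of the direct sum.  The coproduct and the counit of
    [dsum_coalg] are convertible to instances of it. *)
Definition dsum_elim (W : lmodType k) (F : forall i, V i -> W) x : W :=
  \sum_(i \in dsupp (dsum_val x)) F i (dsum_val x i).

Section Elim.
Variables (W : lmodType k) (F : forall i, V i -> W).
Hypothesis FL : forall i, linear (@F i).

Lemma dsum_elimEw (D : {fset I}) x :
  (forall i, dsum_val x i != 0 -> i \in D) ->
  dsum_elim F x = \sum_(i <- D) F (dsum_val x i).
Proof.
move=> xD; have fin := dsum_finite x.
rewrite /dsum_elim; apply: fsbig_fwiden; first by move=> i /xD.
  exact: fset_uniq.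
move=> i [_ /negP xi] /=; have -> : dsum_val x i = 0.
  by apply/eqP/negPn.
exact: (lin0 (@FL i)).
Qed.

Lemma dsum_elim_linear : linear (dsum_elim F).
Proof.
move=> a x y.
pose S (z : dsum V) := fset_set (dsupp (dsum_val z)).
have inS z i : dsum_val z i != 0 -> i \in S z.
  by move=> zi; rewrite in_fset_set ?inE //; exact: dsum_finite.
pose D := (S x `|` S y `|` S (a *: x + y)%R)%fset.
rewrite !(dsum_elimEw (D := D)).
- rewrite scaler_sumr -big_split; apply: eq_bigr => i _.
  by rewrite dsum_valP (@FL i).
- by move=> i /inS iS; rewrite !inE iS orbT.
- by move=> i /inS iS; rewrite !inE iS.
- by move=> i /inS iS; rewrite !inE iS orbT.
Qed.

Lemma dsum_elim_in i (v : V i) : dsum_elim F (dsum_in v) = F v.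
Proof.
rewrite (dsum_elimEw (D := [fset i]%fset)); last first.
  move=> j; rewrite inE; apply: contraNT => ij.
  by rewrite dsum_in_other // eq_sym.
by rewrite big_seq_fset1 dsum_in_same.
Qed.

End Elim.
End DirectSumTheory.

Section DirectSumCoalgebra.
Variables (k : fieldType) (I : choiceType) (C : I -> coalgData k).
Hypothesis comulL : forall i, linear (@comul k (C i)).
Hypothesis counitL : forall i, linear (@counit k (C i) : C i -> k^o).

Let comul_part i (c : C i) : (dsum C ⊗ dsum C)%type :=
  \tsum_(c1, c2 <- comul c) dsum_in (V := C) (i := i) c1 ⊗ dsum_in (V := C) c2.

Let comul_part_linear i : linear (@comul_part i).
Proof.
have inL := @dsum_in_linear k I C i; have cL := @comulL i.
by rewrite /comul_part; lin.
Qed.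

Lemma dsum_comul_linear : linear (@comul k (dsum_coalg C)).
Proof. exact: dsum_elim_linear comul_part_linear. Qed.

Lemma dsum_comul_in i (c : C i) :
  comul (dsum_in (V := C) c : dsum_coalg C) =
  \tsum_(c1, c2 <- comul c) (dsum_in (V := C) (i := i) c1 : dsum_coalg C) ⊗
    (dsum_in (V := C) c2 : dsum_coalg C).
Proof. exact: dsum_elim_in comul_part_linear _ _. Qed.

Lemma dsum_counit_linear : linear (@counit k (dsum_coalg C) : _ -> k^o).
Proof. exact: (dsum_elim_linear (W := k^o) counitL). Qed.

Lemma dsum_counit_in i (c : C i) :
  counit (dsum_in (V := C) c : dsum_coalg C) = counit c.
Proof. exact: (dsum_elim_in (W := k^o) counitL). Qed.

Lemma dsum_in_family i r (e : 'I_r -> 'I_r -> C i) : comatrix_family e ->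
  comatrix_family (C := dsum_coalg C) (fun a b => dsum_in (V := C) (e a b)).
Proof.
have inL := @dsum_in_linear k I C i.
move=> [eD eE]; split=> a b; last by rewrite dsum_counit_in eE.
by rewrite dsum_comul_in eD tsum_sum_tens //; lin.
Qed.

End DirectSumCoalgebra.

Section ComatrixCoalgebra.
Variables (k : fieldType) (r : nat).

Lemma comatrix_comul_linear : linear (@comul k (comatrix_coalg k r)).
Proof. exact: lext_is_linear. Qed.

Lemma comatrix_counit_linear :
  linear (@counit k (comatrix_coalg k r) : _ -> k^o).
Proof. exact: lext_is_linear. Qed.

Lemma comatrix_basis_family : comatrix_family (C := comatrix_coalg k r)
  (fun a b => << (a, b) >>).
Proof. by split=> a b; rewrite /= lextU. Qed.

End ComatrixCoalgebra.

(** * The Yetter-Drinfeld structure *)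

Section Main.
Variables (k : fieldType) (G GG : groupType).
Variables (pi : {multiplicative G -> grp_aut GG}) (theta : grp_aut GG).

Local Notation H := (galg k G).
Local Notation B := (galg k GG).
Local Notation act := (@galg_act k G GG pi).
Local Notation Theta := (@galg_map k GG theta).

Hypothesis finite_orbits : forall x : GG, finite_set (aut_orbit theta x).
Hypothesis theta_diag : @diagonalizable k B Theta.
Hypothesis pi_theta : forall g : G, pi g \o theta = theta \o pi g.
Variable U : set (kunits k).
Hypothesis U_def : U = generated [set a : kunits k |
  @eigenvalue k B Theta (kunit_val a)].
Variables (bU : set G) (bold : kunits k -> G).
Hypothesis bU_subgroup : is_subgroup bU.
Hypothesis bU_ker_center : bU `<=` [set g | pi g = 1%g] `&` gcenter G.
Hypothesis bold_bij : set_bij U bU bold.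
Hypothesis bold_mul : {in U &, {morph bold : a b / (a * b)%g}}.

(** [U] and [bold] seen on scalars, so that eigenvalues need not be packaged with
    a proof that they are invertible. *)
Definition eigen_scalar (a : k) : Prop := exists2 u, U u & kunit_val u = a.
Definition bolds (a : k) : G := bold (insubd (1%g : kunits k) a).

Lemma boldsE u : bolds (kunit_val u) = bold u.
Proof. by rewrite /bolds -[kunit_val u]/(val u) valKd. Qed.

Lemma U_subgroup : is_subgroup U.
Proof. by rewrite U_def; exact: generated_subgroup. Qed.

Lemma eigen_scalar_neq0 a : eigen_scalar a -> a != 0.
Proof. by case=> u _ <-; exact: kunitP. Qed.

Lemma eigen_scalar1 : eigen_scalar 1.
Proof. by exists 1%g => //; exact: subgroup1 U_subgroup. Qed.

Lemma eigen_scalarM a b :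
  eigen_scalar a -> eigen_scalar b -> eigen_scalar (a * b).
Proof.
move=> [u uU <-] [v vU <-]; exists (u * v)%g => //.
exact: subgroupM U_subgroup _ _.
Qed.

Lemma eigen_scalarX a n : eigen_scalar a -> eigen_scalar (a ^+ n).
Proof.
move=> aU; elim: n => [|n IH]; first exact: eigen_scalar1.
by rewrite exprS; exact: eigen_scalarM.
Qed.

Lemma boldsM a b : eigen_scalar a -> eigen_scalar b ->
  bolds (a * b) = (bolds a * bolds b)%g.
Proof.
move=> [u uU <-] [v vU <-]; rewrite !boldsE -bold_mul ?inE //.
exact: (boldsE (u * v)%g).
Qed.

Lemma bolds1 : bolds 1 = 1%g.
Proof.
apply: (@mulgI _ (bolds 1)).
by rewrite -(boldsM eigen_scalar1 eigen_scalar1) mulr1 mulg1.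
Qed.

Lemma boldsX a n : eigen_scalar a -> bolds (a ^+ n) = (bolds a ^+ n)%g.
Proof.
move=> aU; elim: n => [|n IH]; first exact: bolds1.
by rewrite exprS expgS boldsM ?IH //; exact: eigen_scalarX.
Qed.

Lemma bolds_bU a : eigen_scalar a -> bU (bolds a).
Proof.
move=> [u uU <-]; rewrite boldsE; have [funU _ _] := bold_bij; exact: funU.
Qed.

Lemma bolds_inj a b : eigen_scalar a -> eigen_scalar b ->
  bolds a = bolds b -> a = b.
Proof.
move=> [u uU <-] [v vU <-]; rewrite !boldsE; have [_ injU _] := bold_bij.
by move/injU => ->; rewrite ?inE.
Qed.

Lemma bolds_ker a : eigen_scalar a -> pi (bolds a) = 1%g.
Proof. by move=> /bolds_bU/bU_ker_center[]. Qed.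

Lemma bolds_comm a g : eigen_scalar a -> commute (bolds a) g.
Proof. by move=> /bolds_bU/bU_ker_center[_]; apply. Qed.

Lemma eigenvalue_scalar a (b : B) : eigenspace Theta a b -> b != 0 ->
  eigen_scalar a.
Proof.
move=> ab b0; have a0 : a != 0.
  apply: contraNneq b0 => a0; rewrite /eigenspace /= a0 scale0r in ab.
  by apply/eqP/(galg_map_inj (f := theta)); rewrite ab (lin0 (galg_map_linear _)).
exists (KUnit a0) => //; rewrite U_def; apply: sub_generated.
by exists b.
Qed.

Lemma theta_act (g : G) (b : B) :
  galg_map (pi g) (Theta b) = Theta (galg_map (pi g) b).
Proof.
move: b; apply: malg_ext => [||x]; [lin|lin|].
have E : pi g (theta x) = theta (pi g x).
  exact: (congr1 (fun s => s x) (pi_theta g)).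
by rewrite !galg_mapU E.
Qed.

(** The eigenvectors span [B], and the eigenvalue of a nonzero one lies in [U]. *)
Lemma eigen_ext (X : lmodType k) (p q : B -> X) : linear p -> linear q ->
  (forall a b, eigen_scalar a -> eigenspace Theta a b -> p b = q b) ->
  forall b, p b = q b.
Proof.
move=> pL qL pq b; apply: (lspan_ext pL qL (S := \bigcup_a eigenspace Theta a)).
  move=> {}b [a _ ab]; have [->|b0] := eqVneq b 0.
    by rewrite (lin0 pL) (lin0 qL).
  by apply: (pq a b) => //; exact: eigenvalue_scalar ab b0.
by rewrite theta_diag.
Qed.

Lemma orbit_root x : exists r z,
  [/\ orbit_cycle theta x r, r.-primitive_root z & eigen_scalar z].
Proof.
have [r xr] := finite_orbit_cycle (finite_orbits x).
have [z zr] := diagonalizable_prim_root xr theta_diag.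
exists r, z; split=> //.
have [b ab b0] := unity_root_eigenvalue xr (prim_expr_order zr).
exact: eigenvalue_scalar ab b0.
Qed.

Lemma exists_coaction : exists rho : B -> (H ⊗ B)%type, linear rho /\
  forall a : kunits k, U a -> forall b : B,
    eigenspace Theta (kunit_val a) b -> rho b = (<< bold a >> : H) ⊗ b.
Proof.
have [||rho rhoL rhoE] := linear_by_eigenspaces
  (phi := fun a (b : B) => (<< bolds a >> : H) ⊗ b) _ theta_diag.
- exact: galg_map_linear.
- by move=> a; lin.
by exists rho; split=> // a _ b ab; rewrite (rhoE _ _ ab) boldsE.
Qed.

Variable rho : B -> (H ⊗ B)%type.
Hypothesis rho_linear : linear rho.
Hypothesis rho_bold : forall a : kunits k, U a -> forall b : B,
  eigenspace Theta (kunit_val a) b -> rho b = (<< bold a >> : H) ⊗ b.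

Lemma rho_eigen a (b : B) : eigen_scalar a -> eigenspace Theta a b ->
  rho b = (<< bolds a >> : H) ⊗ b.
Proof. by move=> [u uU <-] /(rho_bold uU); rewrite boldsE. Qed.

(** Decompose the translate [a] of [x] into eigenvectors, apply the coaction to
    each, and collect the coefficient of each translate [b]. *)
Lemma orbit_coaction x r z a : orbit_cycle theta x r -> r.-primitive_root z ->
  eigen_scalar z -> (a < r)%N ->
  rho << iter a theta x >> = \sum_(b < r)
    cyclic_coef (bolds z) r (z ^+ a / z ^+ b) ⊗ (<< iter b theta x >> : B).
Proof.
move=> [r0 fr _] zr zU ar.
have Fr : iter r Theta << x >> = (<< x >> : B) by rewrite iter_galg_map fr.
pose e c := spectral Theta r (<< x >> : B) (z ^+ 0 / z ^+ c).
have eE c : rho (e c) = (<< (bolds z ^+ c)%g >> : H) ⊗ e c.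
  rewrite -boldsX //; apply: rho_eigen; first exact: eigen_scalarX.
  rewrite -[X in eigenspace _ X]invrK -[X in eigenspace _ X^-1]mul1r.
  apply: (spectral_eigen (galg_map_linear _) Fr).
  by rewrite div1r exprVn exprAC (prim_expr_order zr) expr1n invr1.
rewrite -iter_galg_map (spectral_inversion Theta _ 0 zr ar) (linS rho_linear).
transitivity (\sum_(c < r) \sum_(b < r)
    ((z ^+ c) ^+ a * (r%:R^-1 * (z ^- c) ^+ b)) *:
    ((<< (bolds z ^+ c)%g >> : H) ⊗ (<< iter b theta x >> : B))).
  apply: eq_bigr => c _; rewrite (linZ rho_linear) -/(e c) eE /e /spectral.
  rewrite expr0 divr1 div1r tens_scaler tens_sumr !scaler_sumr.
  apply: eq_bigr => b _; rewrite tens_scaler !scalerA iter_galg_map.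
  by rewrite mulrA.
rewrite exchange_big; apply: eq_bigr => b _ /=.
rewrite cyclic_coef_def tens_scalel tens_suml scaler_sumr; apply: eq_bigr => c _.
rewrite tens_scalel scalerA; refine (congr1 (fun d => d *: _) _).
by rewrite mulrCA expr_div_n exprAC exprVn [(z ^+ c) ^+ b]exprAC.
Qed.

Local Notation M := (@YdData k H B act rho).

Lemma eigen_galg_map g a b : eigenspace Theta a b ->
  eigenspace Theta a (galg_map (pi g) b).
Proof.
by rewrite /eigenspace /= -theta_act => ->; rewrite (linZ (galg_map_linear _)).
Qed.

Lemma yd_module : is_module M.
Proof.
split=> [|m|h h' m] /=.
- by split=> x /=; [exact: galg_actr|exact: galg_actl].
- exact: galg_act1.
- exact: galg_actM.
Qed.

Lemma yd_comodule : is_comodule M.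
Proof.
split=> [|m|m] /=; first exact: rho_linear.
- move: m; apply: eigen_ext => [||a b aU ab]; [lin|lin|].
  rewrite (rho_eigen aU ab) !tsum_tens ?lextU ?tsum_tens ?(rho_eigen aU ab);
    try by lin.
  by rewrite tsum_tens //; lin.
- move: m; apply: eigen_ext => [||a b aU ab]; [lin|lin|].
  rewrite (rho_eigen aU ab) tsum_tens ?lextU ?scale1r //; lin.
Qed.

Lemma yd_compatible (h : H) (m : B) :
  \tsum_(h1, h2 <- comul h) \tsum_(l, m0 <- rho m)
    galg_mul h1 l ⊗ act h2 m0 =
  \tsum_(h1, h2 <- comul h) \tsum_(l, m0 <- rho (act h1 m))
    galg_mul l h2 ⊗ m0.
Proof.
move: m; apply: eigen_ext => [||a b aU ab]; [lin|lin|].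
move: h; apply: malg_ext => /= [||g]; [lin|lin|].
rewrite lextU !tsum_tens; try by lin.
rewrite galg_actU (rho_eigen aU ab) (rho_eigen aU (eigen_galg_map g ab)).
rewrite !tsum_tens; try by lin.
by rewrite !galg_mulU galg_actU bolds_comm.
Qed.

Lemma yd_object : is_yd M.
Proof.
by split; [exact: yd_module|exact: yd_comodule|exact: yd_compatible].
Qed.

Lemma eigen_galg_mul a a' b b' : eigenspace Theta a b ->
  eigenspace Theta a' b' -> eigenspace Theta (a * a') (galg_mul b b').
Proof.
rewrite /eigenspace /= galg_mapM => -> ->.
rewrite (linZ (galg_mulr _)) (linZ (galg_mull _)) scalerA.
by [].
Qed.

Lemma eigen_tens_ext (X : lmodType k) (p q : (B ⊗ B)%type -> X) :
  linear p -> linear q ->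
  (forall a b a' b', eigen_scalar a -> eigenspace Theta a b ->
     eigen_scalar a' -> eigenspace Theta a' b' -> p (b ⊗ b') = q (b ⊗ b')) ->
  forall t, p t = q t.
Proof.
move=> pL qL pq; apply: (tens_ext pL qL) => v w.
move: v; apply: eigen_ext => [||a b aU ab]; [lin|lin|].
move: w; apply: eigen_ext => [||a' b' aU' ab']; [lin|lin|].
exact: pq aU ab aU' ab'.
Qed.

Lemma rho_mul a a' b b' : eigen_scalar a -> eigenspace Theta a b ->
  eigen_scalar a' -> eigenspace Theta a' b' ->
  rho (galg_mul b b') = (<< (bolds a * bolds a')%g >> : H) ⊗ galg_mul b b'.
Proof.
move=> aU ab aU' ab'; rewrite -boldsM //.
by apply: rho_eigen; [exact: eigen_scalarM|exact: eigen_galg_mul].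
Qed.

Lemma yd_mul_morphism :
  @is_yd_morphism k H (yd_tensor M M) M (fun t => \tsum_(a, b <- t) galg_mul a b).
Proof.
split=> [|h t|t] /=; first by lin.
- move: h; apply: malg_ext => /= [||g]; [lin|lin|].
  move: t; apply: tens_malg_ext => /= [||x y]; [lin|lin|].
  rewrite lextU. rewrite !tsum_tens; try by lin.
  by rewrite !galg_actU galg_mapM.
- move: t; apply: eigen_tens_ext => [||a b a' b' aU ab aU' ab']; [lin|lin|].
  rewrite !tsum_tens; try by lin.
  rewrite (rho_mul aU ab aU' ab') (rho_eigen aU ab) (rho_eigen aU' ab').
  rewrite !tsum_tens; try by lin.
  by rewrite galg_mulU.
Qed.

Lemma rho1 : rho << 1%g >> = (<< 1%g >> : H) ⊗ (<< 1%g >> : B).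
Proof.
rewrite -bolds1; apply: rho_eigen; first exact: eigen_scalar1.
by rewrite /eigenspace /= galg_mapU aut_fun1 scale1r.
Qed.

Lemma yd_unit_morphism :
  @is_yd_morphism k H (yd_unit H) M (fun c : k => c *: bone B).
Proof.
split=> [|h c|c] /=.
- by move=> a c d; rewrite scalerDl scalerA.
- move: h; apply: malg_ext => /= [||g]; [lin|lin|].
  rewrite lextU galg_actU (linZ (galg_map_linear _)) galg_mapU aut_fun1.
  by rewrite scale1r.
- rewrite tsum_tens; last by lin.
  by rewrite (linZ rho_linear) rho1 tens_scaler.
Qed.

Lemma yd_counit_morphism : @is_yd_morphism k H M (yd_unit H) (@counit k B).
Proof.
split=> [|h m|m] /=; first by exact: (lext_is_linear (V := k^o)).
- move: h; apply: (malg_ext (V := k^o)) => /= [||g]; [lin|lin|].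
  by rewrite lextU galg_actU scale1r; exact: (galg_map_counit (pi g) m).
- move: m; apply: eigen_ext => [||a b aU ab]; [lin|lin|].
  rewrite (rho_eigen aU ab) tsum_tens; last by lin.
  (* The counit is invariant under [theta], so it vanishes on the eigenspaces
     for eigenvalues other than 1. *)
  have := galg_map_counit theta b; rewrite (ab : Theta b = a *: b).
  rewrite /= linearZ /=; set e := lext _ b => aE.
  have [->|a1] := eqVneq a 1; first by rewrite bolds1.
  suff -> : e = 0 by rewrite !(lin0 ((tens_bilinear _ _).2 _)).
  apply: (@mulfI _ (a - 1)); first by rewrite subr_eq0.
  by rewrite mulr0 mulrBl mul1r; apply/eqP; rewrite subr_eq0; apply/eqP.
Qed.

Lemma yd_antipode_morphism :
  is_yd_morphism (M := M) (N := M) (@galg_antipode k GG).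
Proof.
split=> [|h m|m] /=; first exact: galg_antipode_linear.
- move: h; apply: malg_ext => /= [||g]; [lin|lin|].
  by rewrite !galg_actU galg_map_antipode.
- move: m; apply: eigen_ext => [||a b aU ab]; [lin|lin|].
  rewrite (rho_eigen aU ab) tsum_tens; last by lin.
  apply: rho_eigen => //; rewrite /eigenspace /= galg_map_antipode.
  by rewrite (ab : Theta b = a *: b) (linZ (@galg_antipode_linear _ _)).
Qed.

Lemma yd_comul_morphism :
  @is_yd_morphism k H M (yd_tensor M M) (@comul k B).
Proof.
split=> [|h m|m] /=; first exact: lext_is_linear.
- move: h; apply: malg_ext => /= [||g]; [lin|lin|].
  move: m; apply: malg_ext => /= [||x]; [lin|lin|].
  rewrite galg_actU galg_mapU !lextU !tsum_tens; try by lin.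
  by rewrite galg_actU galg_mapU.
- move: m; apply: malg_ext => /= [||x]; [lin|lin|].
  (* The coefficients of [rho x] are orthogonal idempotents, so only the
     diagonal terms of the product of [rho x] with itself survive. *)
  have [r [z [xr zr zU]]] := orbit_root x; have [r0 _ _] := xr.
  have rhox := orbit_coaction xr zr zU r0; rewrite /= in rhox.
  have rn0 := prim_root_natf_neq0 zr.
  have ur : (bolds z ^+ r = 1)%g.
    by rewrite -boldsX // (prim_expr_order zr) bolds1.
  have zX b : (z ^+ 0 / z ^+ b) ^+ r = 1 by exact: root_ratioX.
  rewrite lextU !tsum_tens; try by lin.
  rewrite rhox !tsum_sum_tens; try by lin.
  apply: eq_bigr => b _; rewrite tsum_sum_tens; last by lin.
  rewrite lextU (bigD1 b) //= cyclic_coef_mul // eqxx big1 ?addr0 // => c cb.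
  rewrite cyclic_coef_mul // ifN ?(lin0 ((tens_bilinear _ _).1 _)) //.
  apply: contraNneq cb => /(congr1 (fun w => w^-1)).
  rewrite !invf_div expr0 !divr1 => /eqP.
  by rewrite (prim_root_inj zr) // eq_sym.
Qed.

Lemma yd_comul_mul (a b : B) : comul (galg_mul a b : B) =
  \tsum_(a1, a2 <- comul a) \tsum_(b1, b2 <- comul b)
    \tsum_(l, a20 <- rho a2) galg_mul a1 (act l b1) ⊗ galg_mul a20 b2.
Proof.
move: b; apply: malg_ext => /= [||y]; [lin|lin|].
(* [bU] acts trivially, so the braiding of [B] with itself is the flip. *)
transitivity (\tsum_(a1, a2 <- comul a)
    galg_mul a1 (<< y >> : B) ⊗ galg_mul a2 (<< y >> : B)).
  move: a; apply: malg_ext => /= [||x]; [lin|lin|].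
  by rewrite galg_mulU !lextU tsum_tens ?galg_mulU //; lin.
congr tsum; apply/funext => a1; apply/funext => a2.
rewrite lextU tsum_tens; last by lin.
move: a2; apply: eigen_ext => [||c b cU cb]; [lin|lin|].
rewrite (rho_eigen cU cb) tsum_tens; last by lin.
by rewrite galg_actU bolds_ker // galg_map1.
Qed.

Theorem group_algebra_yd_hopf : is_yd_hopf act rho (@galg_antipode k GG).
Proof.
split.
- exact: yd_object.
- by split; [exact: galg_is_algebra|exact: galg_is_coalgebra].
- split; [exact: yd_mul_morphism|exact: yd_unit_morphism
    |exact: yd_comul_morphism|exact: yd_counit_morphism
    |exact: yd_antipode_morphism].
- split; [exact: galg_counit_multiplicative|exact: galg_comulU
    |exact: yd_comul_mul].
- exact: galg_is_antipode.
Qed.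

(** * The biproduct *)

Local Notation P := (biproduct act rho).
Local Notation pmul := (@biprod_mul k H B act).
Local Notation pcomul := (@biprod_comul k H B rho).
Local Notation pcounit := (@biprod_counit k H B).

Lemma biprod_mull x : linear (pmul x).
Proof. by rewrite /biprod_mul /=; lin. Qed.

Lemma biprod_mulr y : linear (fun x => pmul x y).
Proof. by rewrite /biprod_mul /=; lin. Qed.

Lemma biprod_comul_linear : linear pcomul.
Proof. by rewrite /biprod_comul /=; lin. Qed.

Lemma biprod_counit_linear : linear (pcounit : (B ⊗ H)%type -> k^o).
Proof.
apply: tsum_linear; split=> [h|b] /=.
  by move=> a x y; rewrite linearP /= mulrDl; congr (_ + _); exact/esym/mulrA.
by move=> a x y; rewrite linearP /= mulrDr; congr (_ + _); exact: mulrCA.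
Qed.

Lemma biprod_mulE (b b' : B) g h :
  pmul (b ⊗ (<< g >> : H)) (b' ⊗ (<< h >> : H)) =
  galg_mul b (galg_map (pi g) b') ⊗ (<< (g * h)%g >> : H).
Proof.
rewrite /biprod_mul /= !tsum_tens; try by lin.
by rewrite lextU tsum_tens ?galg_actU ?galg_mulU //; lin.
Qed.

Lemma biprod_comulE x (h : H) : pcomul ((<< x >> : B) ⊗ h) =
  \tsum_(l, v <- rho << x >>) \tsum_(h1, h2 <- comul h)
    ((<< x >> : B) ⊗ (galg_mul l h1 : H)) ⊗ (v ⊗ h2).
Proof.
rewrite /biprod_comul /= tsum_tens; last by lin.
by rewrite lextU tsum_tens //; lin.
Qed.

Lemma biprod_counitE x (h : H) : pcounit ((<< x >> : B) ⊗ h) = counit h.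
Proof.
rewrite /biprod_counit tsum_tens ?galg_counitU ?mul1r //.
split=> [h'|b] /= a u v.
  by rewrite linearP /= mulrDl; congr (_ + _); exact/esym/mulrA.
by rewrite linearP /= mulrDr; congr (_ + _); exact: mulrCA.
Qed.

(** For [x] with orbit of length [r] and a primitive [r]-th root of unity [z],
    the entries with [a, b < r] span the block of the orbit of [x] and the coset
    of [g]. *)
Definition biprod_entry r z x g (a b : nat) : P :=
  (<< iter a theta x >> : B) ⊗
    (galg_mul (cyclic_coef (bolds z) r (z ^+ a / z ^+ b)) << g >> : H).

Lemma bolds_order r z : r.-primitive_root z -> eigen_scalar z ->
  (bolds z ^+ r = 1)%g.
Proof. by move=> zr zU; rewrite -boldsX // (prim_expr_order zr) bolds1. Qed.

Lemma comul_coef_mul r z a b g : r.-primitive_root z ->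
  comul (galg_mul (cyclic_coef (bolds z) r (z ^+ a / z ^+ b)) << g >> : H) =
  \sum_(c < r)
    (galg_mul (cyclic_coef (bolds z) r (z ^+ a / z ^+ c)) << g >> : H) ⊗
    (galg_mul (cyclic_coef (bolds z) r (z ^+ c / z ^+ b)) << g >> : H).
Proof.
move=> zr.
have comul_mulg (h : H) : comul (galg_mul h << g >> : H) =
    \tsum_(h1, h2 <- comul h)
      (galg_mul h1 << g >> : H) ⊗ (galg_mul h2 << g >> : H).
  move: h; apply: malg_ext => /= [||h]; [lin|lin|].
  by rewrite galg_mulU !lextU tsum_tens ?galg_mulU //; lin.
by rewrite comul_mulg (cyclic_coef_comul (bolds z) a b zr) tsum_sum_tens //; lin.
Qed.

(** In the coproduct, the coaction on the translate [a] of [x] contributes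
    coefficients [(a, p)] and the coproduct of the coefficient [(a, b)]
    contributes products of [(a, c)] and [(c, b)]; orthogonality of the
    idempotents [(a, p)] and [(a, c)] leaves [p = c], which is the comatrix
    formula. *)
Lemma biprod_entry_family r z x g : orbit_cycle theta x r ->
  r.-primitive_root z -> eigen_scalar z ->
  comatrix_family (fun a b : 'I_r => biprod_entry r z x g a b).
Proof.
move=> xr zr zU; have rn0 := prim_root_natf_neq0 zr.
have ur := bolds_order zr zU; have wr a b := root_ratioX zr a b.
have mulA (h h' : H) :
    galg_mul h (galg_mul h' << g >>) = galg_mul (galg_mul h h') << g >>.
  by have [_ A _ _] := galg_is_algebra k G; exact: A.
have z0 n : z ^+ n != 0 by rewrite expf_neq0 ?(prim_root_neq0 zr).
split=> a b.
- rewrite /biprod_entry [LHS]biprod_comulE comul_coef_mul //.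
  rewrite (orbit_coaction xr zr zU (ltn_ord a)) tsum_sum_tens; last by lin.
  apply: eq_bigr => p _; rewrite tsum_sum_tens; last by lin.
  rewrite (bigD1 p) //= big1 ?addr0 => [|c cp].
    by rewrite mulA cyclic_coef_mul // eqxx.
  rewrite mulA cyclic_coef_mul // ifN.
    rewrite (lin0 (galg_mulr _)) (lin0 ((tens_bilinear _ _).2 _)).
    by rewrite (lin0 ((tens_bilinear _ _).1 _)).
  apply: contraNneq cp => /(mulfI (z0 _))/invr_inj/eqP.
  by rewrite (prim_root_inj zr) // eq_sym.
rewrite [LHS]biprod_counitE; have [_ ->] := galg_counit_multiplicative k G.
rewrite galg_counitU mulr1 cyclic_coef_counit //; congr (nat_of_bool _)%:R.
rewrite -(inj_eq (mulIf (z0 b))) mulfVK // mul1r.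
by rewrite (prim_root_inj zr).
Qed.

(** The Fourier inversion formula in the group generated by [bolds z], translated
    by [g]. *)
Lemma biprod_entry_inversion r z x g a i : r.-primitive_root z ->
  (i < r)%N -> (<< iter a theta x >> : B) ⊗ (<< (bolds z ^+ i * g)%g >> : H) =
  \sum_(b < r) (z ^+ b / z ^+ a) ^+ i *:
    (biprod_entry r z x g a b : (B ⊗ H)%type).
Proof.
move=> zr ir; rewrite -galg_mulU (cyclic_coef_inversion (bolds z) a zr ir).
rewrite (linS (galg_mulr _)) tens_sumr; apply: eq_bigr => b _.
by rewrite (linZ (galg_mulr _)) tens_scaler.
Qed.

Lemma biprod_entries_span : lspan (@comatrix_entries k P) = setT.
Proof.
apply: lspan_full; set S := @comatrix_entries k P.
have piL := lquot_pi_linear S.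
apply: tens_malg_ext => [||x g]; [exact: piL|exact: linear_zero|].
(* Here [x] itself is the base point of its orbit. *)
have [r [z [xr zr zU]]] := orbit_root x; have [r0 _ _] := xr.
have := biprod_entry_inversion x g 0 zr r0; rewrite /= expg0 mul1g => ->.
rewrite (linS piL) big1 // => b _; rewrite (linZ piL) lquot_pi_span ?scaler0 //.
apply: sub_gen_smallest; pose o : 'I_r := Ordinal r0.
exists r, (fun a b : 'I_r => biprod_entry r z x g a b), o, b; split=> //.
exact: biprod_entry_family.
Qed.

Lemma biprod_coalgebra : is_coalgebra P.
Proof.
apply: comatrix_coalgebra; first exact: biprod_comul_linear.
  exact: biprod_counit_linear.
exact: biprod_entries_span.
Qed.

Lemma galg_map_pi_mul g h (b : B) :
  galg_map (pi (g * h)%g) b = galg_map (pi g) (galg_map (pi h) b).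
Proof. by rewrite gmulfM galg_map_mul. Qed.

Lemma galg_map_pi_mulV g h (b : B) : galg_map (pi (g * h)^-1%g) b =
  galg_map (pi h^-1%g) (galg_map (pi g^-1%g) b).
Proof.
have E : (g * h)^-1%g = (h^-1 * g^-1)%g by exact: invgM.
by rewrite E galg_map_pi_mul.
Qed.

Lemma galg_map_pi_bolds a (b : B) : eigen_scalar a ->
  galg_map (pi (bolds a)) b = b.
Proof. by move=> aU; rewrite bolds_ker // galg_map1. Qed.

Lemma galg_map_pi_boldsV a (b : B) : eigen_scalar a ->
  galg_map (pi (bolds a)^-1%g) b = b.
Proof.
move=> aU; rewrite -[in RHS](galg_map1 b) -(mult_hom1 pi) -(mulVg (bolds a)).
by rewrite galg_map_pi_mul galg_map_pi_bolds.
Qed.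

Lemma galg_map_piK g (b : B) : galg_map (pi g) (galg_map (pi g^-1%g) b) = b.
Proof. by rewrite -galg_map_pi_mul mulgV mult_hom1 galg_map1. Qed.

Lemma biprod_algebra : is_algebra P.
Proof.
have mull := biprod_mull; have mulr := biprod_mulr.
split=> [|x y z|x|x] /=.
- by split=> x; [exact: mulr|exact: mull].
- move: x; apply: tens_malg_ext => [||x g]; [lin|lin|].
  move: y; apply: tens_malg_ext => [||y h]; [lin|lin|].
  move: z; apply: tens_malg_ext => [||z l]; [lin|lin|].
  rewrite !biprod_mulE galg_mapM mulgA -galg_map_pi_mul.
  by rewrite !galg_mapU !galg_mulU mulgA.
- move: x; apply: tens_malg_ext => [||x g]; [lin|lin|].
  by rewrite biprod_mulE mult_hom1 galg_map1 galg_mulU !mul1g.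
- move: x; apply: tens_malg_ext => [||x g]; [lin|lin|].
  by rewrite biprod_mulE galg_mapU aut_fun1 galg_mulU !mulg1.
Qed.

Lemma biprod_comulU x g : pcomul ((<< x >> : B) ⊗ (<< g >> : H)) =
  \tsum_(l, v <- rho << x >>)
    ((<< x >> : B) ⊗ (galg_mul l << g >> : H)) ⊗ (v ⊗ (<< g >> : H)).
Proof.
rewrite biprod_comulE; congr tsum; apply/funext => l; apply/funext => v.
by rewrite galg_comulU tsum_tens //; lin.
Qed.

(** Multiplicativity of the coproduct is checked after letting the two
    arguments of [rho] vary independently of the group elements [x] and [y]:
    both sides are then linear in them, and eigenvectors suffice. *)
Lemma biprod_comul_mul (s t : P) : pcomul (pmul s t) =
  \tsum_(s1, s2 <- pcomul s) \tsum_(t1, t2 <- pcomul t) pmul s1 t1 ⊗ pmul s2 t2.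
Proof.
have mull := biprod_mull; have mulr := biprod_mulr.
have comulL := biprod_comul_linear.
move: s; apply: tens_malg_ext => [||x g]; [lin|lin|].
move: t; apply: tens_malg_ext => [||y h]; [lin|lin|].
rewrite biprod_mulE galg_mapU galg_mulU !biprod_comulU.
have gen (p q : B) :
    \tsum_(l, v <- rho (galg_mul p (galg_map (pi g) q)))
      ((<< (x * pi g y)%g >> : B) ⊗ (galg_mul l << (g * h)%g >> : H)) ⊗
      (v ⊗ (<< (g * h)%g >> : H)) =
    \tsum_(l, v <- rho p) \tsum_(l', v' <- rho q)
      pmul ((<< x >> : B) ⊗ (galg_mul l << g >> : H))
           ((<< y >> : B) ⊗ (galg_mul l' << h >> : H)) ⊗
      pmul (v ⊗ (<< g >> : H)) (v' ⊗ (<< h >> : H)).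
  move: p; apply: eigen_ext => [||a p aU ap]; [lin|lin|].
  move: q; apply: eigen_ext => [||a' q aU' aq]; [lin|lin|].
  rewrite (rho_mul aU ap aU' (eigen_galg_map g aq)) (rho_eigen aU ap).
  rewrite (rho_eigen aU' aq) !tsum_tens; try by lin.
  rewrite !galg_mulU !biprod_mulE galg_map_pi_mul galg_map_pi_bolds //.
  rewrite galg_mapU galg_mulU; congr ((_ ⊗ << _ >>) ⊗ _).
  by rewrite -!mulgA; congr (_ * _)%g; rewrite !mulgA (bolds_comm g aU').
have := gen << x >> << y >>; rewrite galg_mapU galg_mulU => ->.
rewrite tsum_tsum; last by lin.
congr tsum; apply/funext => l; apply/funext => v; rewrite tsum_tsum //; lin.
Qed.

Lemma biprod_bialgebra : is_bialgebra P.
Proof.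
have mull := biprod_mull; have mulr := biprod_mulr.
split; [exact: biprod_algebra|exact: biprod_coalgebra|split|
  |exact: biprod_comul_mul].
- by rewrite [LHS]biprod_counitE galg_counitU.
- move=> s t.
  have counitL : linear (pcounit : (B ⊗ H)%type -> k^o).
    exact: biprod_counit_linear.
  move: s; apply: (tens_malg_ext (X := k^o)) => [||x g].
  + exact: (linear_comp counitL (mulr t)).
  + move=> a u v; rewrite /= (counitL a u v) mulrDl; congr (_ + _).
    exact/esym/mulrA.
  move: t; apply: (tens_malg_ext (X := k^o)) => [||y h].
  + exact: (linear_comp counitL (mull _)).
  + move=> a u v; rewrite /= (counitL a u v) mulrDr; congr (_ + _).
    exact: mulrCA.
  rewrite /= biprod_mulE galg_mapU galg_mulU !biprod_counitE !galg_counitU.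
  by rewrite mulr1.
rewrite [LHS]biprod_comulU rho1 tsum_tens; last by lin.
by rewrite galg_mulU mulg1.
Qed.

(** On [b] tensor [g] this is the product of [1] tensor [S (b_(-1) g)] and
    [S b_(0)] tensor [1], simplified by the fact that [b_(-1)] lies in the span of
    [bU], which is central and acts trivially. *)
Definition biprod_antipode (t : P) : P :=
  \tsum_(b, h <- t) \tsum_(l, b0 <- rho b) \tsum_(h1, h2 <- comul h)
    (act (galg_antipode h1) (galg_antipode b0) : B) ⊗
    (galg_mul (galg_antipode l) (galg_antipode h2) : H).

Lemma biprod_antipode_linear : linear biprod_antipode.
Proof. by rewrite /biprod_antipode /=; lin. Qed.

Lemma biprod_antipodeE a (b : B) g : eigen_scalar a -> eigenspace Theta a b ->
  biprod_antipode (b ⊗ (<< g >> : H)) =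
  galg_map (pi g^-1%g) (galg_antipode b) ⊗ (<< (bolds a * g)^-1%g >> : H).
Proof.
move=> aU ab; rewrite /biprod_antipode /= tsum_tens; last by lin.
rewrite (rho_eigen aU ab) tsum_tens; last by lin.
rewrite lextU tsum_tens; last by lin.
by rewrite !galg_antipodeU galg_actU galg_mulU (bolds_comm g aU) invgM.
Qed.

Lemma eigen_antipode a (b : B) : eigenspace Theta a b ->
  eigenspace Theta a (galg_antipode b).
Proof.
rewrite /eigenspace /= galg_map_antipode => ->.
by rewrite (linZ (@galg_antipode_linear _ _)).
Qed.

Lemma biprod_antipodeK : involutive biprod_antipode.
Proof.
have antiL := biprod_antipode_linear.
have ext (b : B) g : biprod_antipode (biprod_antipode (b ⊗ (<< g >> : H))) =
    b ⊗ (<< g >> : H).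
  move: b; apply: eigen_ext => [||a b aU ab]; [lin|lin|].
  have aSb := eigen_galg_map g^-1%g (eigen_antipode ab).
  rewrite (biprod_antipodeE g aU ab) (biprod_antipodeE _ aU aSb).
  rewrite -galg_map_antipode galg_antipodeK invgK galg_map_pi_mul.
  rewrite galg_map_pi_bolds // galg_map_piK.
  by rewrite invgM invgK (bolds_comm g aU) mulgK.
move=> t; move: t; apply: tens_malg_ext => [||x g]; [lin|lin|exact: ext].
Qed.

(** As for the coproduct, the arguments of [rho] are separated from [x] so that
    they may be taken to be eigenvectors.  The first identity then reduces to the
    coaction on [S x * x], that is on [1]. *)
Lemma biprod_is_antipode : is_antipode P biprod_antipode.
Proof.
have mull := biprod_mull; have mulr := biprod_mulr.
have antiL := biprod_antipode_linear; have comulL := biprod_comul_linear.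
have counitL : linear (pcounit : (B ⊗ H)%type -> k^o).
  exact: biprod_counit_linear.
split=> [|t|t] /=; first exact: biprod_antipode_linear.
- move: t; apply: tens_malg_ext => [||x g]; [lin|lin|].
  rewrite biprod_counitE galg_counitU scale1r biprod_comulU.
  rewrite tsum_tsum; last by lin.
  have gen (p q : B) :
      \tsum_(l, v <- rho p)
        pmul (biprod_antipode (q ⊗ (galg_mul l << g >> : H)))
             (v ⊗ (<< g >> : H)) =
      \tsum_(l, w <- rho (galg_mul (galg_antipode q) p))
        galg_map (pi g^-1%g) w ⊗ (galg_antipode l : H).
    move: p; apply: eigen_ext => [||a p aU ap]; [lin|lin|].
    move: q; apply: eigen_ext => [||a' q aU' aq]; [lin|lin|].
    rewrite (rho_mul aU' (eigen_antipode aq) aU ap) (rho_eigen aU ap).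
    rewrite !tsum_tens; try by lin.
    rewrite galg_mulU (biprod_antipodeE _ aU' aq) biprod_mulE.
    rewrite galg_antipodeU [in RHS]galg_mapM.
    have E1 (c : B) : galg_map (pi (bolds a * g)^-1%g) c = galg_map (pi g^-1%g) c.
      by rewrite galg_map_pi_mulV galg_map_pi_boldsV.
    have E2 (c : B) : galg_map (pi (bolds a' * (bolds a * g))^-1%g) c =
        galg_map (pi g^-1%g) c.
      by rewrite !galg_map_pi_mulV !galg_map_pi_boldsV.
    rewrite E1 E2; have c : commute (bolds a' * bolds a)%g g.
      by rewrite -boldsM //; apply: bolds_comm; exact: eigen_scalarM.
    by rewrite [(bolds a' * (_ * _))%g]mulgA (c : _ = _) invgM mulgVK.
  rewrite gen galg_antipodeU galg_mulU mulVg rho1 tsum_tens; last by lin.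
  by rewrite galg_mapU aut_fun1 galg_antipodeU invg1.
- move: t; apply: tens_malg_ext => [||x g]; [lin|lin|].
  rewrite biprod_counitE galg_counitU scale1r biprod_comulU.
  rewrite tsum_tsum; last by lin.
  have gen (p : B) :
      \tsum_(l, v <- rho p)
        pmul ((<< x >> : B) ⊗ (galg_mul l << g >> : H))
             (biprod_antipode (v ⊗ (<< g >> : H))) =
      galg_mul << x >> (galg_antipode p) ⊗ (<< 1%g >> : H).
    move: p; apply: eigen_ext => [||a p aU ap]; [lin|lin|].
    rewrite (rho_eigen aU ap) tsum_tens; last by lin.
    rewrite galg_mulU (biprod_antipodeE _ aU ap) biprod_mulE galg_map_pi_mul.
    by rewrite galg_map_pi_bolds // galg_map_piK mulgV.
  by rewrite gen galg_antipodeU galg_mulU mulgV.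
Qed.

(** * The subgroups of [bU] of given order *)

Definition root_subgroup r z : set G := [set (bolds z ^+ j)%g | j in `I_r].

Lemma root_subgroupX r z n : r.-primitive_root z -> eigen_scalar z ->
  root_subgroup r z (bolds z ^+ n)%g.
Proof.
move=> zr zU; exists (n %% r)%N.
  by rewrite /= ltn_pmod ?(prim_order_gt0 zr).
by rewrite -!boldsX // (prim_expr_mod zr).
Qed.

Lemma bolds_expg_inj r z i j : r.-primitive_root z -> eigen_scalar z ->
  (i < r)%N -> (j < r)%N -> (bolds z ^+ i)%g = (bolds z ^+ j)%g -> i = j.
Proof.
move=> zr zU ir jr; rewrite -!boldsX // => E.
apply/eqP; rewrite -(prim_root_inj zr) //; apply/eqP.
by apply: bolds_inj E; exact: eigen_scalarX.
Qed.

Lemma root_subgroup_order r z : r.-primitive_root z -> eigen_scalar z ->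
  subgroups_of_order bU r (root_subgroup r z).
Proof.
move=> zr zU; have ur := bolds_order zr zU.
split.
- apply/subgroupP; split=> [|_ _ [i _ <-] [j jr <-]].
    exact: (root_subgroupX 0 zr zU).
  suff -> : (bolds z ^+ i / bolds z ^+ j)%g = (bolds z ^+ (i + (r - j)))%g.
    exact: root_subgroupX.
  by rewrite expgnDr (expgnFr _ (ltnW jr)) ur div1g.
- by move=> _ [j _ <-]; apply: (subgroupX _ bU_subgroup); exact: bolds_bU.
apply: inj_card_eq => i j /set_mem ir /set_mem jr.
exact: (bolds_expg_inj zr zU ir jr).
Qed.

(** Multiplication by an element of [K] permutes [K], so its [r]-th power cancels
    from the product of all elements of [K]; the product is taken in the field,
    through the isomorphism of [bU] with [U]. *)
Lemma finite_subgroup_exponent r K a : subgroups_of_order bU r K ->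
  eigen_scalar a -> K (bolds a) -> a ^+ r = 1.
Proof.
move=> [KG KbU Kr] aU aK.
have finK : finite_set K by apply/finite_setP; exists r.
have /choice[s sP] : forall h, exists c, bU h -> eigen_scalar c /\ bolds c = h.
  move=> h.
  have [hbU|nh] := pselect (bU h); last by exists 1.
  have [_ _ surj] := bold_bij; have [u uU <-] := surj h hbU.
  by exists (kunit_val u) => _; split; [exists u|exact: boldsE].
pose F := fset_set K.
have FK h : (h \in F) = (h \in K) by rewrite in_fset_set.
have s0 h : h \in F -> s h != 0.
  rewrite FK inE => /KbU/sP[sU _]; exact: eigen_scalar_neq0.
have sM h : h \in F -> s (bolds a * h)%g = a * s h.
  rewrite FK inE => hK; have [shU she] := sP h (KbU _ hK).
  have ahK : K (bolds a * h)%g by exact: subgroupM.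
  have [sahU sahe] := sP _ (KbU _ ahK).
  apply: bolds_inj => //; first exact: eigen_scalarM.
  by rewrite sahe boldsM // she.
have permF : perm_eq [seq (bolds a * h)%g | h <- F] F.
  apply: uniq_perm => [||h]; rewrite ?fset_uniq //.
    by rewrite map_inj_uniq ?fset_uniq //; exact: mulgI.
  apply/mapP/idP => [[h' h'F ->]|hF].
    by move: h'F; rewrite !FK !inE; exact: subgroupM.
  exists ((bolds a)^-1 * h)%g; last by rewrite mulVKg.
  move: hF; rewrite !FK !inE => hK.
  by apply: subgroupM => //; exact: subgroupV.
have : \prod_(h <- F) s h = a ^+ r * \prod_(h <- F) s h.
  rewrite -{1}(perm_big _ permF) big_map /= big_seq.
  rewrite (eq_bigr (fun h => a * s h)) => [|h /sM //].
  have Fr : size F = r by exact: card_fset_set.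
  by rewrite -big_seq big_split /= big_const_seq count_predT iter_mulr_1 Fr.
rewrite -{1}[\prod_(h <- F) s h]mul1r => /mulIf E; apply/esym/E.
by rewrite prodf_seq_neq0; apply/allP => h hF /=; exact: s0.
Qed.

(** The elements of [K] come from [r]-th roots of unity, and all of these are
    powers of [z]. *)
Lemma subgroups_of_order_unique r z K : r.-primitive_root z -> eigen_scalar z ->
  subgroups_of_order bU r K -> K = root_subgroup r z.
Proof.
move=> zr zU KP; have [_ KbU Kr] := KP.
have [_ _ Rr] := root_subgroup_order zr zU.
have finK : finite_set K by apply/finite_setP; exists r.
have finR : finite_set (root_subgroup r z) by apply/finite_setP; exists r.
have KR : K `<=` root_subgroup r z.
  move=> g gK; have [_ _ surj] := bold_bij.
  have [u uU ug] := surj g (KbU g gK).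
  have vU : eigen_scalar (kunit_val u) by exists u.
  have := finite_subgroup_exponent KP vU; rewrite boldsE ug => /(_ gK) vr.
  have [i iE] := prim_rootP zr vr.
  by exists i => //=; rewrite -boldsX // -iE boldsE.
suff E : fset_set K = fset_set (root_subgroup r z).
  by rewrite -(fset_setK finK) E fset_setK.
apply/eqP; rewrite eqEfcard (card_fset_set Kr) (card_fset_set Rr) leqnn andbT.
by rewrite -fset_set_sub.
Qed.

Lemma subgroup_of_orderE r z : r.-primitive_root z -> eigen_scalar z ->
  subgroup_of_order bU r = root_subgroup r z.
Proof.
move=> zr zU; apply: subgroups_of_order_unique => //.
by apply: getPex; exists (root_subgroup r z); exact: root_subgroup_order.
Qed.

(** * The decomposition into comatrix coalgebras *)

Local Notation ocard O := (#|` fset_set (val O)|).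
Local Notation orbits := (aut_orbits theta).
Local Notation osubgroup O := (subgroup_of_order bU (ocard O)).
Local Notation ocosets O := (lcosets (osubgroup O)).
Local Notation D := (dsum_coalg (fun O : orbits =>
  copies (ocosets O) (comatrix_coalg k (ocard O)))).

Lemma orbit_base (O : orbits) : exists p : GG * k,
  [/\ orbit_cycle theta p.1 (ocard O), val O = aut_orbit theta p.1,
      (ocard O).-primitive_root p.2 & eigen_scalar p.2].
Proof.
have /set_mem[x _ xO] := valP O; have [r [z [xr zr zU]]] := orbit_root x.
by exists (x, z); rewrite -xO /= (card_orbit_cycle xr).
Qed.

Definition orbit_point (O : orbits) : GG := (projT1 (cid (orbit_base O))).1.
Definition orbit_scalar (O : orbits) : k := (projT1 (cid (orbit_base O))).2.

Lemma orbit_baseP (O : orbits) :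
  [/\ orbit_cycle theta (orbit_point O) (ocard O),
      val O = aut_orbit theta (orbit_point O),
      (ocard O).-primitive_root (orbit_scalar O) &
      eigen_scalar (orbit_scalar O)].
Proof. exact: (projT2 (cid (orbit_base O))). Qed.

Lemma coset_base (O : orbits) (C : ocosets O) :
  exists g, val C = [set (g * s)%g | s in osubgroup O].
Proof. by have /set_mem[g _ gC] := valP C; exists g. Qed.

Definition coset_point (O : orbits) (C : ocosets O) : G :=
  projT1 (cid (coset_base C)).

Lemma coset_pointP (O : orbits) (C : ocosets O) :
  val C = [set (coset_point C * s)%g | s in osubgroup O].
Proof. exact: (projT2 (cid (coset_base C))). Qed.

Lemma osubgroupE (O : orbits) :
  osubgroup O = root_subgroup (ocard O) (orbit_scalar O).
Proof. by have [_ _ zr zU] := orbit_baseP O; exact: subgroup_of_orderE. Qed.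

Definition block_entry (O : orbits) (C : ocosets O) (a b : 'I_(ocard O)) : P :=
  biprod_entry (ocard O) (orbit_scalar O) (orbit_point O) (coset_point C) a b.

Definition block_basis (O : orbits) (C : ocosets O) (a b : 'I_(ocard O)) : D :=
  dsum_in (V := fun O : orbits => copies (ocosets O) (comatrix_coalg k (ocard O)))
    (dsum_in (V := fun _ : ocosets O => comatrix_coalg k (ocard O)) (i := C)
       << (a, b) >>).

Definition from_blocks : D -> P :=
  dsum_elim
    (V := fun O : orbits => copies (ocosets O) (comatrix_coalg k (ocard O)))
    (W := P) (fun O =>
  dsum_elim (V := fun _ : ocosets O => comatrix_coalg k (ocard O))
    (W := P) (fun C => lext (fun p => block_entry C p.1 p.2))).

Lemma from_blocks_linear : linear from_blocks.
Proof.
apply: dsum_elim_linear => O; apply: dsum_elim_linear => C.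
exact: lext_is_linear.
Qed.

Lemma from_blocks_basis (O : orbits) (C : ocosets O) a b :
  from_blocks (block_basis C a b) = block_entry C a b.
Proof.
rewrite /from_blocks /block_basis dsum_elim_in => [|O']; last first.
  by apply: dsum_elim_linear => C'; exact: lext_is_linear.
rewrite dsum_elim_in => [|C']; last exact: lext_is_linear.
by rewrite lextU.
Qed.

Lemma blocks_linear_ext (X : lmodType k) (p q : D -> X) : linear p -> linear q ->
  (forall O (C : ocosets O) a b, p (block_basis C a b) = q (block_basis C a b)) ->
  forall d, p d = q d.
Proof.
move=> pL qL pq; apply: dsum_linear_ext => // O.
have inL := @dsum_in_linear k orbits
  (fun O : orbits => copies (ocosets O) (comatrix_coalg k (ocard O))) O.
apply: dsum_linear_ext => [||C].
- exact: linear_comp pL inL.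
- exact: linear_comp qL inL.
have inL' :=
  @dsum_in_linear k (ocosets O) (fun _ => comatrix_coalg k (ocard O)) C.
apply: malg_ext => [||[a b]].
- exact: (linear_comp pL (linear_comp inL inL')).
- exact: (linear_comp qL (linear_comp inL inL')).
exact: pq.
Qed.

(** The vector [d] is the Fourier expansion of [x] tensor [g] in the basis of the
    block of the orbit of [x] and the coset of [g].  This is a relation, because
    the index types of a block depend on its orbit; it is shown to be functional
    and a function is then chosen from it. *)
Definition block_vector x g (d : D) : Prop :=
  exists (O : orbits) (C : ocosets O) (a i : 'I_(ocard O)),
  [/\ x = iter a theta (orbit_point O),
      g = (bolds (orbit_scalar O) ^+ i * coset_point C)%g &
      d = \sum_(b < ocard O)
        (orbit_scalar O ^+ b / orbit_scalar O ^+ a) ^+ i *: block_basis C a b].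

Lemma block_vector_exists x g : exists d, block_vector x g d.
Proof.
have xO : aut_orbit theta x \in orbits by apply/mem_set; exists x.
pose O : orbits := exist _ (aut_orbit theta x) xO.
have [yr yO zr zU] := orbit_baseP O.
have : aut_orbit theta x x by have := aut_orbit_iter theta x 0.
rewrite -[X in X x]/(val O) yO (aut_orbit_cycle yr) => -[a ar xE].
have gC : [set (g * s)%g | s in osubgroup O] \in ocosets O.
  by apply/mem_set; exists g.
pose C : ocosets O := exist (fun X : set G => X \in ocosets O) _ gC.
have : val C g.
  exists 1%g; last by rewrite mulg1.
  by rewrite osubgroupE; exact: (root_subgroupX 0 zr zU).
rewrite coset_pointP osubgroupE => -[_ [i ir <-] gE].
eexists; exists O, C, (Ordinal ar), (Ordinal ir); split; last by [].
  by rewrite /= xE.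
by rewrite /= -boldsX // (bolds_comm _ (eigen_scalarX i zU)) boldsX.
Qed.

Lemma block_vector_unique x g d d' :
  block_vector x g d -> block_vector x g d' -> d = d'.
Proof.
move=> [O [C [a [i [xE gE ->]]]]] [O' [C' [a' [i' [xE' gE' ->]]]]].
have orbE (Q : orbits) (c : 'I_(ocard Q)) : x = iter c theta (orbit_point Q) ->
    val Q = aut_orbit theta x.
  have [yr yO _ _] := orbit_baseP Q => ->.
  by rewrite (aut_orbit_same yr (ltn_ord c)).
have OO : O' = O by apply: val_inj; rewrite /= (orbE _ _ xE) (orbE _ _ xE').
subst O'; have [yr _ zr zU] := orbit_baseP O.
have cosE (Q : ocosets O) (j : 'I_(ocard O)) :
    g = (bolds (orbit_scalar O) ^+ j * coset_point Q)%g ->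
    val Q = [set (g * s)%g | s in osubgroup O].
  move=> gQ; rewrite coset_pointP osubgroupE.
  have [SG _ _] := root_subgroup_order zr zU.
  have uS n := root_subgroupX n zr zU.
  have gQ' : g = (coset_point Q * bolds (orbit_scalar O) ^+ j)%g.
    by rewrite gQ -boldsX // (bolds_comm _ (eigen_scalarX j zU)).
  rewrite gQ'; apply/seteqP; split=> _ [s sS <-]; last first.
    exists (bolds (orbit_scalar O) ^+ j * s)%g; last by rewrite mulgA.
    exact: subgroupM.
  exists ((bolds (orbit_scalar O) ^+ j)^-1 * s)%g.
    by apply: subgroupM => //; exact: subgroupV.
  by rewrite mulgA mulgK.
have CC : C' = C by apply: val_inj; rewrite /= (cosE _ _ gE) (cosE _ _ gE').
subst C'.
have aa : a' = a.
  have [_ _ inj] := yr; apply: val_inj; apply: inj; rewrite ?ltn_ord //.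
  by rewrite -xE -xE'.
subst a'.
suff -> : i' = i by [].
apply: val_inj; apply: (bolds_expg_inj zr zU); rewrite ?ltn_ord //.
by apply: (@mulIg _ (coset_point C)); rewrite -gE -gE'.
Qed.

Lemma from_blocks_vector x g d : block_vector x g d ->
  from_blocks d = (<< x >> : B) ⊗ (<< g >> : H).
Proof.
move=> [O [C [a [i [-> -> ->]]]]]; have [_ _ zr _] := orbit_baseP O.
rewrite (linS from_blocks_linear).
rewrite (biprod_entry_inversion _ _ a zr (ltn_ord i)).
apply: eq_bigr => b _; rewrite (linZ from_blocks_linear).
by rewrite from_blocks_basis.
Qed.

(** The inverse is defined on [x] tensor [g] by the Fourier expansion; on the
    entries of a block it is computed by orthogonality of the characters of the
    cyclic group of order [ocard O]. *)
Theorem block_decomposition : exists Phi : P -> D,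
  [/\ linear Phi, cancel Phi from_blocks, cancel from_blocks Phi &
      forall O (C : ocosets O) a b, Phi (block_entry C a b) = block_basis C a b].
Proof.
have /choice[F FP] : forall p : GG * G, exists d, block_vector p.1 p.2 d.
  by move=> p; exact: block_vector_exists.
pose Phi : P -> D := fun t => \tsum_(b, h <- t)
  lext (fun x => lext (fun g => F (x, g)) h) b.
have PhiL : linear Phi by rewrite /Phi; lin.
have PhiU x g : Phi ((<< x >> : B) ⊗ (<< g >> : H)) = F (x, g).
  by rewrite /Phi tsum_tens ?lextU //; lin.
have PhiE O (C : ocosets O) a b : Phi (block_entry C a b) = block_basis C a b.
  have [_ _ zr zU] := orbit_baseP O.
  set z := orbit_scalar O in zr zU *; set r := ocard O in zr a b *.
  have z0 n : z ^+ n != 0 by rewrite expf_neq0 ?(prim_root_neq0 zr).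
  rewrite /block_entry /biprod_entry cyclic_coef_def.
  rewrite (linZ (galg_mulr _)) (linS (galg_mulr _)) tens_scaler tens_sumr.
  rewrite (linZ PhiL) (linS PhiL).
  transitivity (r%:R^-1 *: \sum_(j < r) \sum_(p < r)
      (z ^+ p / z ^+ b) ^+ j *: block_basis C a p).
    refine (congr1 (fun d => _ *: d) _); apply: eq_bigr => j _.
    rewrite (linZ (galg_mulr _)) tens_scaler (linZ PhiL) galg_mulU PhiU.
    have jV : block_vector
        (iter a theta (orbit_point O)) (bolds z ^+ j * coset_point C)%g
        (\sum_(p < r) (z ^+ p / z ^+ a) ^+ j *: block_basis C a p).
      by exists O, C, a, j.
    rewrite -(block_vector_unique jV (FP (_, _))) scaler_sumr.
    apply: eq_bigr => p _; rewrite scalerA.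
    refine (congr1 (fun d => d *: _) _).
    by rewrite -exprMn mulrC mulrA mulfVK.
  exact: (root_sum_orthogonal (block_basis C a) b zr).
exists Phi; split=> //.
- apply: tens_malg_ext => [||x g].
  + exact: linear_comp from_blocks_linear PhiL.
  + exact: linear_id.
  by rewrite PhiU; apply: from_blocks_vector; exact: (FP (_, _)).
apply: blocks_linear_ext => [||O C a b].
- exact: linear_comp PhiL from_blocks_linear.
- exact: linear_id.
by rewrite from_blocks_basis PhiE.
Qed.

Lemma block_entry_family (O : orbits) (C : ocosets O) :
  comatrix_family (block_entry C).
Proof. by have [yr _ zr zU] := orbit_baseP O; exact: biprod_entry_family. Qed.

(** The blocks are simple, with dual functionals given by the coordinates of the
    block decomposition, and they span. *)
Theorem biprod_cosemisimple : cosemisimple P.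
Proof.
have [Phi [PhiL PhiK _ PhiE]] := block_decomposition.
pose block (O : orbits) (C : ocosets O) : set P :=
  lspan [set block_entry C p.1 p.2 | p in [set: 'I_(ocard O) * 'I_(ocard O)]].
have block_simple O (C : ocosets O) : is_simple_subcoalgebra (block O C).
  have [[r0 _ _] _ _ _] := orbit_baseP O.
  pose phi a b (t : P) : k^o := (dsum_val (dsum_val (Phi t) O) C)@_(a, b).
  apply: (@comatrix_family_simple k P biprod_comul_linear _
    (@block_entry O C) phi) => //.
  - exact: block_entry_family.
  - by move=> a b c s t; rewrite /phi PhiL !dsum_valP mcoeffD mcoeffZ.
  move=> a b p q; rewrite /phi PhiE /block_basis !dsum_in_same mcoeffU.
  by rewrite xpair_eqE eq_sym [q == b]eq_sym.
apply: lspan_full => t; set S := \bigcup_(_ in _) _.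
have piL := lquot_pi_linear S; rewrite -(PhiK t).
apply: (blocks_linear_ext (p := fun d => lquot_pi S (from_blocks d))
  (q := fun=> 0)) => [||O C a b].
- exact: linear_comp piL from_blocks_linear.
- exact: linear_zero.
rewrite from_blocks_basis; apply: lquot_pi_span.
apply: sub_gen_smallest; exists (block O C); first exact: block_simple.
by apply: sub_gen_smallest; exists (a, b).
Qed.

Theorem biprod_decomposition : coalg_iso P D.
Proof.
have [Phi [PhiL PhiK blocksK PhiE]] := block_decomposition.
have comulP := biprod_comul_linear; have fbL := from_blocks_linear.
have copL (O : orbits) := @dsum_comul_linear k (ocosets O) (fun=> _)
  (fun=> @comatrix_comul_linear k (ocard O)).
have copE (O : orbits) := @dsum_counit_linear k (ocosets O) (fun=> _)
  (fun=> @comatrix_counit_linear k (ocard O)).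
have comulL : linear (@comul k D) by exact: dsum_comul_linear copL.
have counitL : linear (@counit k D : D -> k^o) by exact: dsum_counit_linear copE.
have famB (O : orbits) (C : ocosets O) : comatrix_family (block_basis C).
  apply: (dsum_in_family copL copE).
  apply: (@dsum_in_family _ _ _ (fun=> @comatrix_comul_linear _ _)
    (fun=> @comatrix_counit_linear _ _)).
  exact: comatrix_basis_family.
exists Phi; split=> //; first by exists from_blocks.
- move=> c; rewrite -{2}(PhiK c); move: (Phi c).
  apply: blocks_linear_ext => [||O C a b]; [exact: comulL|lin|].
  have [famD _] := block_entry_family C; have [famD' _] := famB O C.
  rewrite from_blocks_basis famD famD' tsum_sum_tens; last by lin.
  by apply: eq_bigr => p _; rewrite !PhiE.
- move=> c; rewrite -{2}(PhiK c); move: (Phi c).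
  have pcounitL : linear (pcounit : (B ⊗ H)%type -> k^o).
    exact: biprod_counit_linear.
  apply: (blocks_linear_ext (X := k^o)) => [||O C a b].
  + exact: counitL.
  + exact: linear_comp pcounitL fbL.
  have [_ famE] := block_entry_family C; have [_ famE'] := famB O C.
  by rewrite from_blocks_basis famE famE'.
Qed.

End Main.

Theorem theorem2 (k : fieldType) (G GG : groupType)
    (pi : {multiplicative G -> grp_aut GG}) (theta : grp_aut GG)
    (finite_orbits : forall x : GG, finite_set (aut_orbit theta x))
    (theta_diag : @diagonalizable k (galg k GG) (galg_map theta))
    (pi_theta : forall g : G, pi g \o theta = theta \o pi g)
    (U : set (kunits k))
    (U_def : U = generated [set a : kunits k |
       @eigenvalue k (galg k GG) (galg_map theta) (kunit_val a)])
    (bU : set G) (bold : kunits k -> G)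
    (bU_subgroup : is_subgroup bU)
    (bU_ker_center : bU `<=` [set g | pi g = 1%g] `&` gcenter G)
    (bold_bij : set_bij U bU bold)
    (bold_mul : {in U &, {morph bold : a b / (a * b)%g}}) :
  let H := galg k G in
  let B := galg k GG in
  let act : H -> B -> B := galg_act pi in
  let is_coaction (rho : B -> (H ⊗ B)%type) :=
    linear rho /\
    (forall a : kunits k, U a -> forall b : B,
       @eigenspace k B (galg_map theta) (kunit_val a) b ->
       rho b = (<< bold a >> : H) ⊗ b) in
  let card (O : set GG) := #|` fset_set O| in
  (exists rho, is_coaction rho) /\
  (forall O, O \in aut_orbits theta ->
     exists! K, subgroups_of_order bU (card O) K) /\
  (forall rho, is_coaction rho ->
     is_yd_hopf act rho (@galg_antipode k GG) /\
     (let P := biproduct act rho in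
      (exists S : P -> P, is_hopf P S /\ involutive S) /\
      cosemisimple P /\
      coalg_iso P
        (dsum_coalg (fun O : aut_orbits theta =>
           copies (lcosets (subgroup_of_order bU (card (val O))))
             (comatrix_coalg k (card (val O))))))).
Proof.
move=> H B act is_coaction card; split; [|split].
- exact (exists_coaction theta_diag U bold).
- move=> O /set_mem[x _ <-].
  have [r [z [xr zr zU]]] := orbit_root finite_orbits theta_diag U_def x.
  rewrite /card (card_orbit_cycle xr); exists (root_subgroup bold r z); split.
    exact (root_subgroup_order U_def bU_subgroup bold_bij bold_mul zr zU).
  move=> K KP; apply/esym.
  exact (subgroups_of_order_unique U_def bU_subgroup bold_bij bold_mul zr zU KP).
move=> rho [rhoL rhoE]; split.
  exact (group_algebra_yd_hopf finite_orbits theta_diag pi_theta U_def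
    bU_ker_center bold_bij bold_mul rhoL rhoE).
move=> P; split; [|split].
- exists (@biprod_antipode k G GG pi rho); split; [split|].
  + exact (biprod_bialgebra finite_orbits theta_diag pi_theta U_def
      bU_ker_center bold_bij bold_mul rhoL rhoE).
  + exact (biprod_is_antipode theta_diag U_def bU_ker_center bold_bij bold_mul
      rhoL rhoE).
  + exact (biprod_antipodeK theta_diag pi_theta U_def bU_ker_center bold_bij
      rhoL rhoE).
- exact (biprod_cosemisimple finite_orbits theta_diag U_def bU_subgroup
    bU_ker_center bold_bij bold_mul rhoL rhoE).
- exact (biprod_decomposition finite_orbits theta_diag U_def bU_subgroup
    bU_ker_center bold_bij bold_mul rhoL rhoE).
Qed.
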